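(* Let $\sigma>0$, $\beta>0$ and $N\ge1$. For all $\lambda\in W^N_{d,+}$ we have $$\left[\nu_\beta^N\Lambda_{N,\sigma}\right](\lambda)=\eta_{\beta,\sigma}^N(\lambda),$$ where $[\nu_\beta^N\Lambda_{N,\sigma}](\lambda)=\int_{W^N_{c,+}}\nu_\beta^N(dx)\,\Lambda_{N,\sigma}(x,\lambda)$.
   Context: Notation. $\mathbb{Z}_+=\{0,1,2,\dots\}$, $W^N_{c,+}=\{x\in[0,\infty)^N: x_1\le\cdots\le x_N\}$, $\mathring{W}^N_{c,+}$ is the subset of $W^N_{c,+}$ where no two coordinates coincide, $W^N_{d,+}=\{y\in\mathbb{Z}_+^N: y_1<\cdots<y_N\}$, and $\Delta_N(x)=\prod_{1\le i<j\le N}(x_j-x_i)$. The Laguerre ensemble $\nu_\beta^N$ is the probability measure on $W^N_{c,+}$ given by $$\nu_\beta^N(dx)=\mathrm{const}_{N,\beta}\,\Delta_N(x)^2\prod_{i=1}^N\frac{1}{\Gamma(\beta)}x_i^{\beta-1}e^{-x_i}\,dx_i,$$ with $\mathrm{const}_{N,\beta}$ the normalizing constant. The Meixner ensemble $\eta_{\beta,\sigma}^N$ is the probability measure on $W^N_{d,+}$ given by $$\eta_{\beta,\sigma}^N(\lambda)=\mathrm{const}_{N,\beta,\sigma}\,\Delta_N(\lambda)^2\prod_{i=1}^N\eta_{\beta,\sigma}(\lambda_i),\qquad \eta_{\beta,\sigma}(n)=\sigma^n(1+\sigma)^{-n-\beta}\binom{n+\beta-1}{n},$$ with $\mathrm{const}_{N,\beta,\sigma}$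 the normalizing constant and $\binom{n+\beta-1}{n}=\frac{\Gamma(n+\beta)}{n!\,\Gamma(\beta)}$. The Markov kernel $\Lambda_{N,\sigma}$ from $W^N_{c,+}$ to $W^N_{d,+}$ is given for $x\in\mathring{W}^N_{c,+}$ by $$\Lambda_{N,\sigma}(x,y)=\sigma^{-\frac{N(N-1)}{2}}\frac{\Delta_N(y)}{\Delta_N(x)}\det\left(\frac{(\sigma x_i)^{y_j}e^{-\sigma x_i}}{y_j!}\right)_{i,j=1}^N,\quad y\in W^N_{d,+},$$ extended by continuity to all $x\in W^N_{c,+}$. *)

(* Defs.v *)
From HB Require Import structures.
From mathcomp Require Import all_boot all_order all_algebra.
From mathcomp Require Import all_classical all_reals all_analysis.
From mathcomp Require Import measurable_realfun.

Set Implicit Arguments.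
Unset Strict Implicit.
Unset Printing Implicit Defensive.

Import Order.TTheory GRing.Theory Num.Theory.
Import numFieldNormedType.Exports.

Local Open Scope classical_set_scope.
Local Open Scope ring_scope.

(* Lebesgue measure on R^n, realized on n.-tuple R with its product
   sigma-algebra: R^0 carries the unit mass and R^(n+1) the image of the
   product of the Lebesgue measures of R and R^n under (a, t) |-> a :: t. *)
Section lebesgue_tuple.
Context {R : realType}.

Definition cons_pair n (p : measurableTypeR R * n.-tuple R) : n.+1.-tuple R :=
  [tuple of p.1 :: p.2].

Definition lebesgue_cons n
    (m : {sigma_finite_measure set (n.-tuple R) -> \bar R}) :
    set (n.+1.-tuple R) -> \bar R :=
  pushforward (lebesgue_measure \x m)%E (@cons_pair n).

Lemma measurable_cons_pair n : measurable_fun setT (@cons_pair n).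
Proof.
apply: (@measurable_cons _ _ _ _ (fun p : measurableTypeR R * n.-tuple R =>
  p.1 : R) n snd); [exact: measurable_fst | exact: measurable_snd].
Qed.

Section instances.
Variables (n : nat) (m : {sigma_finite_measure set (n.-tuple R) -> \bar R}).

Let mu : {measure set _ -> \bar R} := (lebesgue_measure \x m)%E.

Let mu_sigma_finite : sigma_finite setT mu.
Proof.
have /sigma_finiteP[F [TF ndF Foo]] := sigma_finiteT (@lebesgue_measure R).
have /sigma_finiteP[G [TG ndG Goo]] := sigma_finiteT m.
exists (fun i => F i `*` G i).
  rewrite -setXTT TF TG predeqE => -[x y]; split.
    move=> [/= [i _ Fix] [k _ Gky]]; exists (maxn i k) => //; split.
    - by move: x Fix; exact/subsetPset/ndF/leq_maxl.
    - by move: y Gky; exact/subsetPset/ndG/leq_maxr.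
  by move=> [i _ []/= ? ?]; split; exists i.
move=> k; have [? ?] := Foo k; have [? ?] := Goo k.
split; first exact: measurableX.
rewrite /mu/= product_measure1E// lte_mul_pinfty// ge0_fin_numE//.
Qed.

Let mcons0 : lebesgue_cons m set0 = 0%E.
Proof. by rewrite /lebesgue_cons /pushforward preimage_set0 (measure0 mu). Qed.

Let mcons_ge0 A : (0 <= lebesgue_cons m A)%E.
Proof. exact: (measure_ge0 mu). Qed.

Let mcons_sigma_additive : semi_sigma_additive (lebesgue_cons m).
Proof.
move=> F mF tF mUF; rewrite /lebesgue_cons /pushforward preimage_bigcup.
have mc (A : set (n.+1.-tuple R)) : measurable A ->
    measurable (@cons_pair n @^-1` A).
  by move=> mA; rewrite -[X in measurable X]setTI; exact: measurable_cons_pair.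
apply: (@measure_semi_sigma_additive _ _ _ mu (fun k => @cons_pair n @^-1` F k)).
- by move=> k; exact: mc.
- apply/trivIsetP => /= i j _ _ ij; rewrite -preimage_setI.
  by move/trivIsetP : tF => /(_ _ _ _ _ ij) ->//; rewrite preimage_set0.
- by rewrite -preimage_bigcup; exact: mc.
Qed.

HB.instance Definition _ := isMeasure.Build _ _ _ (lebesgue_cons m)
  mcons0 mcons_ge0 mcons_sigma_additive.

Let mcons_sigma_finite : sigma_finite setT (lebesgue_cons m).
Proof.
have [F FT Foo] := mu_sigma_finite.
pose g (t : n.+1.-tuple R) : measurableTypeR R * n.-tuple R :=
  (thead t, [tuple of behead t]).
have gK : cancel (@cons_pair n) g.
  by move=> [a t]; rewrite /g /cons_pair/= theadE; congr pair; exact: val_inj.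
have mg : measurable_fun setT g.
  apply/measurable_fun_pair => /=; last exact: measurable_behead.
  exact: (@measurable_tnth _ R n.+1 ord0).
exists (fun i => g @^-1` F i).
  by rewrite -preimage_bigcup -FT preimage_setT.
move=> i; have [mFi Fioo] := Foo i; split.
  by rewrite -[X in measurable X]setTI; exact: mg.
rewrite /lebesgue_cons /pushforward -comp_preimage.
rewrite (_ : g \o (@cons_pair n) = id) ?preimage_id//.
by apply/funext => p /=; rewrite gK.
Qed.

HB.instance Definition _ := @Measure_isSigmaFinite.Build _ _ _
  (lebesgue_cons m) mcons_sigma_finite.

End instances.

Fixpoint lebesgue_tuple n : {sigma_finite_measure set (n.-tuple R) -> \bar R} :=
  match n with
  | 0 => @dirac _ _ [tuple] R
  | n'.+1 => lebesgue_cons (lebesgue_tuple n')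
  end.

End lebesgue_tuple.

Definition Gamma {R : realType} (a : R) : R :=
  \int[lebesgue_measure]_(t in `]0, +oo[) (t `^ (a - 1) * expR (- t)).

Section ensembles.
Context {R : realType} (N : nat).

Definition weyl_c : set (N.-tuple R) :=
  [set x | (forall i : 'I_N, 0 <= tnth x i) /\
           (forall i j : 'I_N, (i <= j)%N -> tnth x i <= tnth x j)].

Definition weyl_c_distinct : set (N.-tuple R) :=
  [set x | weyl_c x /\ injective (tnth x)].

Definition weyl_d : set (N.-tuple nat) :=
  [set y | forall i j : 'I_N, (i < j)%N -> (tnth y i < tnth y j)%N].

Definition vandermonde (x : 'I_N -> R) : R :=
  \prod_(i < N) \prod_(j < N | (i < j)%N) (x j - x i).

(* The value of powR at 0 (where x ^ (beta - 1) is infinite for beta < 1) only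
   matters on a Lebesgue-null set. *)
Definition laguerre_density (beta : R) (x : N.-tuple R) : R :=
  vandermonde (tnth x) ^+ 2 *
  \prod_(i < N)
    ((Gamma beta)^-1 * (tnth x i) `^ (beta - 1) * expR (- tnth x i)).

(* For beta > 0 the total mass is finite and positive, so that neither fine nor
   the inverse meets its default value; likewise for meixner_const below. *)
Definition laguerre_const (beta : R) : R :=
  (fine (\int[lebesgue_tuple N]_(x in weyl_c) (laguerre_density beta x)%:E)%E)^-1.

Definition laguerre (beta : R) : set (N.-tuple R) -> \bar R := fun A =>
  ((laguerre_const beta)%:E *
   \int[lebesgue_tuple N]_(x in A `&` weyl_c) (laguerre_density beta x)%:E)%E.

Lemma Gamma_ge0 (a : R) : 0 <= Gamma a.
Proof.
by apply: Rintegral_ge0 => t _; rewrite mulr_ge0 ?powR_ge0 ?expR_ge0.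
Qed.

Lemma laguerre_density_ge0 beta x : 0 <= laguerre_density beta x.
Proof.
rewrite mulr_ge0 ?sqr_ge0// prodr_ge0// => i _.
by rewrite !mulr_ge0 ?invr_ge0 ?Gamma_ge0 ?powR_ge0 ?expR_ge0.
Qed.

Lemma measurable_laguerre_density beta :
  measurable_fun setT (laguerre_density beta).
Proof.
have mt (i : 'I_N) : measurable_fun setT (fun x : N.-tuple R => tnth x i).
  exact: measurable_tnth.
apply: measurable_funM.
  apply: measurable_funX; rewrite /vandermonde.
  apply: measurable_prod => i _.
  under eq_fun do rewrite big_mkcond.
  apply: measurable_prod => j _.
  case: (i < j)%N => //; exact: measurable_funB.
apply: measurable_prod => i _; apply: measurable_funM.
  apply: measurable_funM => //.
  exact: (measurableT_comp (measurable_powR _) (mt i)).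
apply: measurableT_comp => //; exact: measurableT_comp.
Qed.

Lemma measurable_weyl_c : measurable weyl_c.
Proof.
have mt (i : 'I_N) : measurable_fun setT (fun x : N.-tuple R => tnth x i).
  exact: measurable_tnth.
have -> : weyl_c =
    (\bigcap_(i in [set: 'I_N]) [set x | 0 <= tnth x i]) `&`
    (\bigcap_(i in [set: 'I_N]) \bigcap_(j in [set j : 'I_N | (i <= j)%N])
      [set x | tnth x i <= tnth x j]).
  apply/seteqP; split=> x /=.
    by move=> [x0 xS]; split=> [i _|i _ j ij] /=; [exact: x0 | exact: xS].
  move=> [x0 xS]; split=> [i|i j ij]; first exact: x0.
  exact: (xS i I j ij).
have mle (f g : N.-tuple R -> R) : measurable_fun setT f ->
    measurable_fun setT g -> measurable [set x | f x <= g x].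
  move=> mf mg; rewrite -[X in measurable X]setTI.
  exact: measurable_fun_le.
apply: measurableI.
  by apply: fin_bigcap_measurable => // i _; exact: mle.
apply: fin_bigcap_measurable => // i _.
by apply: fin_bigcap_measurable => // j _; exact: mle.
Qed.

Section laguerre_measure.
Variable beta : R.

Let laguerre_const_ge0 : 0 <= laguerre_const beta.
Proof.
rewrite /laguerre_const invr_ge0 fine_ge0// integral_ge0// => x _.
by rewrite lee_fin laguerre_density_ge0.
Qed.

Let weight : set (N.-tuple R) -> \bar R := fun A =>
  (\int[lebesgue_tuple N]_(x in A `&` weyl_c) (laguerre_density beta x)%:E)%E.

Let weight_sigma_additive : semi_sigma_additive weight.
Proof.
rewrite (_ : weight = fun A => (\int[lebesgue_tuple N]_(x in A)
    (((fun x => (laguerre_density beta x)%:E) \_ weyl_c) x))%E); last first.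
  by apply/funext => A; rewrite /weight integral_mkcondr.
apply: semi_sigma_additive_nng_induced.
  apply/(measurable_restrictT _ measurable_weyl_c).
  apply: measurable_funTS; apply/measurable_EFinP.
  exact: measurable_laguerre_density.
by apply: erestrict_ge0 => x _; rewrite lee_fin laguerre_density_ge0.
Qed.

Let laguerre0 : laguerre beta set0 = 0%E.
Proof. by rewrite /laguerre set0I integral_set0 mule0. Qed.

Let weight_ge0 A : (0 <= weight A)%E.
Proof. by apply: integral_ge0 => x _; rewrite lee_fin laguerre_density_ge0. Qed.

Let laguerre_ge0 A : (0 <= laguerre beta A)%E.
Proof. by rewrite /laguerre mule_ge0 ?lee_fin//; exact: weight_ge0. Qed.

Let laguerre_sigma_additive : semi_sigma_additive (laguerre beta).
Proof.
move=> F mF tF mUF.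
rewrite [X in X @ _ --> _](_ : _ = (fun n => (laguerre_const beta)%:E *
    \sum_(0 <= i < n) weight (F i))%E); last first.
  by apply/funext => n; rewrite ge0_sume_distrr// => i _; exact: weight_ge0.
by apply: cvgeZl => //; exact: weight_sigma_additive.
Qed.

HB.instance Definition _ := isMeasure.Build _ _ _ (laguerre beta)
  laguerre0 laguerre_ge0 laguerre_sigma_additive.

End laguerre_measure.

Definition gen_binomial (beta : R) (n : nat) : R :=
  Gamma (n%:R + beta) / (n`!%:R * Gamma beta).

Definition meixner_weight (beta sigma : R) (n : nat) : R :=
  sigma ^+ n * (1 + sigma) `^ (- n%:R - beta) * gen_binomial beta n.

Definition meixner_density (beta sigma : R) (y : N.-tuple nat) : R :=
  vandermonde (fun i => (tnth y i)%:R) ^+ 2 *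
  \prod_(i < N) meixner_weight beta sigma (tnth y i).

Definition meixner_const (beta sigma : R) : R :=
  (fine (\esum_(y in weyl_d) (meixner_density beta sigma y)%:E)%E)^-1.

(* A probability mass function on weyl_d; only its values there are meaningful. *)
Definition meixner (beta sigma : R) (y : N.-tuple nat) : R :=
  meixner_const beta sigma * meixner_density beta sigma y.

Definition kernel_formula (sigma : R) (x : N.-tuple R) (y : N.-tuple nat) : R :=
  sigma ^- ((N * N.-1)./2) *
  (vandermonde (fun j => (tnth y j)%:R) / vandermonde (tnth x)) *
  \det (\matrix_(i < N, j < N)
    ((sigma * tnth x i) ^+ tnth y j * expR (- (sigma * tnth x i))
     / (tnth y j)`!%:R)).

(* 'rV[R]_N, unlike N.-tuple R, carries the topology of R^N. *)
Definition tuple_of_row (z : 'rV[R]_N) : N.-tuple R :=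
  [tuple z ord0 i | i < N].

(* On weyl_c, where weyl_c_distinct is dense, the limit is the extension by
   continuity; outside weyl_c the value is irrelevant. *)
Definition Lambda (sigma : R) (x : N.-tuple R) (y : N.-tuple nat) : R :=
  if x \in weyl_c_distinct then kernel_formula sigma x y
  else lim (kernel_formula sigma (tuple_of_row z) y
    @[z --> within (tuple_of_row @^-1` weyl_c_distinct)
                   (nbhs (\row_i tnth x i))]).

End ensembles.

Arguments weyl_c {R} N.
Arguments weyl_c_distinct {R} N.

(* Main.v *)
(** Write [G(a, c)] for the integral of [x^(a-1) e^(-c x)] over the half-line.
    By the Andreief identity, the integral of [det (f_j x_i) * det (g_j x_i)]
    over the ordered tuples is the determinant of the pairings of the [f_i]
    with the [g_j]. With [f_i = x^i] and [g_j] the gamma density times the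
    Poisson weight of [lambda_j], the pairings are values of [G], and the
    recurrence of Gamma turns them into monic polynomials in [lambda_j], so that
    [nu Lambda] is the squared Vandermonde determinant of [lambda] times the
    Meixner weights, up to a constant.

    The constant is identified without using that [Lambda] is Markov. The mass
    of the Laguerre ensemble is the Hankel determinant of the numbers
    [Gamma (i + j + beta) / Gamma beta]. Replacing the monomials by falling and
    rising factorials, the mass of the Meixner ensemble is the same determinant
    with entries multiplied by [sigma^i (1 + sigma)^j], by the negative binomial
    series. *)

From HB Require Import structures.
Require Import Defs.
From mathcomp Require Import all_boot all_order all_algebra all_fingroup.
From mathcomp Require Import all_classical all_reals all_analysis.
From mathcomp Require Import measurable_realfun ring.

Set Implicit Arguments.
Unset Strict Implicit.
Unset Printing Implicit Defensive.

Import Order.TTheory GRing.Theory Num.Theory.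
Import numFieldNormedType.Exports.
Local Open Scope classical_set_scope.
Local Open Scope ring_scope.

(** * Gamma integrals *)

Section gamma.
Context {R : realType}.
Notation mu := (@lebesgue_measure R).

Let measurable_scale (c : R) :
  measurable_fun setT ( *%R c : measurableTypeR R -> measurableTypeR R).
Proof. exact: measurable_funM. Qed.

(** The image of the Lebesgue measure under multiplication by [c], times [c], gives every half-open
    interval its length, and this property characterizes the Lebesgue measure. *)
Lemma lebesgue_measure_scale (c : R) (A : set R) : 0 < c -> measurable A ->
  (mu A = c%:E * mu ( *%R c @^-1` A))%E.
Proof.
move=> c0 mA.
pose m : {measure set (measurableTypeR R) -> \bar R} :=
  mscale (NngNum (ltW c0))
    (pushforward mu ( *%R c : measurableTypeR R -> measurableTypeR R)).
suff : mu A = m (measurable_scale c) A by [].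
apply: lebesgue_measure_unique => // X [[a b] _ <-] /=.
rewrite /m /mscale/= /pushforward.
rewrite [X in (_ * mu X)%E](_ : _ = `]c^-1 * a, c^-1 * b]%classic); last first.
  by apply/seteqP; split => x /=; rewrite !in_itv/= ltr_pdivrMl// ler_pdivlMl.
rewrite !lebesgue_measure_itv /= !lte_fin ltr_pM2l ?invr_gt0//.
case: ifP => _; last by rewrite mule0.
by rewrite -!EFinB -EFinM -mulrBr mulrA divff ?mul1r// gt_eqF.
Qed.

Lemma ge0_integral_scale (c : R) (f : R -> \bar R) : 0 < c ->
  measurable_fun setT f -> (forall x, 0 <= f x)%E ->
  (\int[mu]_x f x = c%:E * \int[mu]_x f (c * x)%R)%E.
Proof.
move=> c0 mf f0.
pose m : {measure set (measurableTypeR R) -> \bar R} :=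
  mscale (NngNum (ltW c0))
    (pushforward mu ( *%R c : measurableTypeR R -> measurableTypeR R)).
rewrite (@eq_measure_integral _ _ _ _ (m (measurable_scale c))) => [|A mA _]; last first.
  exact: lebesgue_measure_scale.
rewrite ge0_integral_mscale//=; congr (_ * _)%E.
by rewrite ge0_integral_pushforward.
Qed.

(** The rate [c] is 1 for the Laguerre weight alone and [1 + sigma] once the Poisson factor of the
    kernel is included. *)
Definition gamma_integrand (a c x : R) : R := x `^ (a - 1) * expR (- (c * x)).

Lemma gamma_integrand_ge0 a c x : 0 <= gamma_integrand a c x.
Proof. by rewrite mulr_ge0 ?powR_ge0 ?expR_ge0. Qed.

Lemma measurable_gamma_integrand a c D : measurable_fun D (gamma_integrand a c).
Proof.
apply: measurable_funTS; apply: measurable_funM; first exact: measurable_powR.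
by apply: measurableT_comp => //; apply: measurableT_comp => //; exact: measurable_funM.
Qed.

(** Valued in the extended reals, so that scaling and recurrence are available before finiteness,
    which is deduced from the recurrence. *)
Definition gamma_integral (a c : R) : \bar R :=
  (\int[mu]_(x in `]0%R, +oo[) (gamma_integrand a c x)%:E)%E.

Lemma gamma_integral_ge0 a c : (0 <= gamma_integral a c)%E.
Proof. by apply: integral_ge0 => x _; rewrite lee_fin gamma_integrand_ge0. Qed.

Lemma gamma_integral_scale a c : 0 < c ->
  gamma_integral a c = ((c `^ (- a))%:E * gamma_integral a 1)%E.
Proof.
move=> c0.
(* The substitution of [c * x] for [x] is made in the integral of rate 1; the finite positive factor
   [c ^ a] is inverted at the end. *)
have h : gamma_integral a 1 = ((c `^ a)%:E * gamma_integral a c)%E.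
  have mg b : measurable_fun setT (EFin \o (gamma_integrand a b \_ `]0, +oo[)).
    apply/measurable_EFinP.
    by apply/(measurable_restrictT _ (measurable_itv _)); exact: measurable_gamma_integrand.
  have g0 b x : (0 <= ((gamma_integrand a b \_ `]0%R, +oo[) x)%:E)%E.
    by rewrite lee_fin patchE; case: ifPn => // _; exact: gamma_integrand_ge0.
  rewrite /gamma_integral integral_mkcond restrict_EFin.
  rewrite [in RHS]integral_mkcond restrict_EFin.
  rewrite (ge0_integral_scale c0)//; last exact: g0.
  have mg1 := measurableT_comp (mg 1) (measurable_scale c).
  rewrite -!ge0_integralZl ?lee_fin ?powR_ge0 ?(ltW c0)//;
 try by [exact: mg|move=> x _; exact: g0].
  apply: eq_integral => x _; rewrite /= -!EFinM; congr EFin.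
  rewrite !patchE !mem_setE !in_itv/= !andbT pmulr_rgt0//.
  case: ifPn => [x0|_]; last by rewrite !mulr0.
  rewrite /gamma_integrand mul1r powRM ?ltW//.
  (* The isolated factor [c] is the Jacobian. *)
  have -> : c `^ a = c * c `^ (a - 1).
    rewrite -[X in _ = X * _]powRr1 ?(ltW c0)// -powRD ?(addrC 1) ?subrK//.
    by rewrite (gt_eqF c0) implybT.
  by ring.
rewrite h muleA -EFinM powRN mulVf ?mul1e// gt_eqF// powR_gt0//.
Qed.

Lemma cvg_powRNy (a : R) : 0 < a -> t `^ (- a) @[t --> +oo] --> 0.
Proof.
move=> a0; under eq_fun do rewrite powRN.
apply/gtr0_cvgV0.
  by near=> t; rewrite powR_gt0//; near: t; exact: nbhs_pinfty_gt.
apply/cvgryPge => A; near=> t.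
have h : 0 <= `|A| + 1 by rewrite addr_ge0.
rewrite (@le_trans _ _ (`|A| + 1))//; first by rewrite (le_trans (ler_norm _))// lerDl.
rewrite -[leLHS]powRr1// -(mulVf (negbT (gt_eqF a0))) powRrM.
have t0 : 0 <= t by near: t; apply: nbhs_pinfty_ge; rewrite num_real.
have tA : (`|A| + 1) `^ a^-1 <= t by near: t; apply: nbhs_pinfty_ge; rewrite num_real.
by apply: (ge0_ler_powR (ltW a0)) => //; rewrite nnegrE// powR_ge0.
Unshelve. all: by end_near. Qed.

Lemma is_derive_continuous (f : R -> R) (x df : R) :
  is_derive x 1 f df -> f z @[z --> x] --> f x.
Proof. by move=> fx; exact/differentiable_continuous/derivable1_diffP/ex_derive. Qed.

(** The total weight obtained when the scaling law of shape [a + 1] is integrated over the rates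
    from 1 on. *)
Lemma integral_powRNS (a : R) : 0 < a ->
  (\int[mu]_(t in `[1%R, +oo[) (t `^ (- (a + 1)))%:E = (a^-1)%:E)%E.
Proof.
move=> a0.
have dF (t : R) : 0 < t ->
    is_derive t 1 (fun t => - (a^-1 * t `^ (- a))) (t `^ (- (a + 1))).
  move=> t0; have := is_derive1_powR (- a) t0 => d.
  have -> : t `^ (- (a + 1)) = - (a^-1 *: (- a * t `^ (- a - 1))).
    rewrite /GRing.scale/= mulNr mulrN opprK mulrA mulVf ?gt_eqF// mul1r.
    by congr (_ `^ _); ring.
  exact: is_deriveN.
rewrite (@ge0_continuous_FTC2y _ _ (fun t => - (a^-1 * t `^ (- a))) _ 0).
- by rewrite powR1 mulr1 sub0e -EFinN opprK.
- by move=> x _; rewrite powR_ge0.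
- apply: derivable_within_continuous => x; rewrite in_itv/= andbT => x1.
  by apply: ex_derive; apply: is_derive1_powR; exact: lt_le_trans x1.
- rewrite -oppr0; apply: cvgN; rewrite -[X in _ --> X](mulr0 (a^-1)).
  by apply: cvgMl_tmp; exact: cvg_powRNy.
- by move=> x x1; apply: ex_derive; apply: dF; exact: lt_trans x1.
- by apply: cvg_at_right_filter; exact: is_derive_continuous (dF _ _).
- move=> x; rewrite in_itv/= andbT => x1; rewrite derive1E.
  by apply: derive_val; apply: dF; exact: lt_trans x1.
Qed.

(** Spreads [e^(-x)] over the rates [t >= 1]; this brings the second variable into the recurrence of
    Gamma. *)
Lemma integral_expRNM (x : R) : 0 < x ->
  (\int[mu]_(t in `[1%R, +oo[) (x * expR (- (t * x)))%:E = (expR (- x))%:E)%E.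
Proof.
move=> x0.
have dF (t : R) : is_derive t 1 (fun t => - expR (- (t * x))) (x * expR (- (t * x))).
  apply: is_derive_eq; rewrite /GRing.scale/=; ring.
have dG (t : R) : derivable (fun t : R => x * expR (- (t * x))) t 1 by [].
rewrite (@ge0_continuous_FTC2y _ _ (fun t => - expR (- (t * x))) _ 0).
- by rewrite mul1r sub0e -EFinN opprK.
- by move=> t _; rewrite mulr_ge0 ?expR_ge0 ?ltW.
- by apply: derivable_within_continuous => t _; exact: dG.
- rewrite -oppr0; apply: cvgN.
  apply: (@cvg_comp _ _ _ (fun t => t * x) (fun z => expR (- z)) _ (pinfty_nbhs R)).
    exact: gt0_cvgMly.
  exact: cvgr_expR.
- by move=> t _; apply: ex_derive; exact: dF.
- by apply: cvg_at_right_filter; exact: is_derive_continuous (dF _).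
- by move=> t _; rewrite derive1E; apply: derive_val; exact: dF.
Qed.

(* Integrating the scaling law over the rate and exchanging the integrals avoids
   an integration by parts at the possible singularity at 0. *)
Lemma gamma_integral_rec (a : R) : 0 < a ->
  (a%:E * gamma_integral a 1 = gamma_integral (a + 1) 1)%E.
Proof.
move=> a0.
(* The function [x^a e^(-y x)] on [x > 0], [y >= 1]. Integrated first in [y] it gives
   [x^(a-1) e^(-x)]; integrated first in [x] it gives [y^(-(a+1))] times the gamma integral at
   [a + 1]. *)
pose F (p : measurableTypeR R * measurableTypeR R) : \bar R :=
  (p.1 `^ a * expR (- (p.2 * p.1)) *
   \1_(`]0, +oo[%classic) p.1 * \1_(`[1, +oo[%classic) p.2)%:E.
have hx : gamma_integral a 1 = (\int[mu]_x \int[mu]_y F (x, y))%E.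
  rewrite /gamma_integral integral_mkcond.
  apply: eq_integral => x _; rewrite patchE mem_setE in_itv/= andbT.
  rewrite /F; under eq_integral do rewrite /= indicE mem_setE in_itv/= andbT.
  case: ifPn => x0; last by rewrite integral0_eq// => y _; rewrite mulr0 mul0r.
  rewrite /gamma_integrand mul1r EFinM -(integral_expRNM x0).
  rewrite -ge0_integralZl//; last 3 first.
  - apply/measurable_EFinP; apply: measurable_funM => //.
    apply: measurableT_comp => //; apply: measurableT_comp => //.
    exact: measurable_funM.
  - by move=> y _; rewrite lee_fin mulr_ge0 ?expR_ge0// ltW.
  - by rewrite lee_fin powR_ge0.
  rewrite integral_mkcond.
  apply: eq_integral => y _; rewrite patchE indicE mulr1.
  case: ifPn => _; last by rewrite mulr0.
  by rewrite mulr1 -(mulr_powRB1 (ltW x0) a0) -EFinM; congr EFin; ring.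
have hy y : (\int[mu]_x F (x, y) =
    (if y \in `[1%R, +oo[%classic
     then (y `^ (- (a + 1)))%:E * gamma_integral (a + 1) 1 else 0))%E.
  rewrite /F/= indicE; case: ifPn => [|_]; last by rewrite integral0_eq// => x _; rewrite mulr0.
  rewrite mem_setE in_itv/= andbT => y1.
  rewrite -gamma_integral_scale; last exact: lt_le_trans y1.
  rewrite /gamma_integral [in RHS]integral_mkcond; apply: eq_integral => x _.
  rewrite patchE indicE mulr1; case: ifPn => _; last by rewrite mulr0.
  by rewrite mulr1 /gamma_integrand addrK.
have mF : measurable_fun setT F.
  apply/measurable_EFinP.
  apply: measurable_funM; last exact: measurableT_comp.
  apply: measurable_funM; last exact: measurableT_comp.
  apply: measurable_funM; first exact: (measurableT_comp (measurable_powR _)).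
  apply: measurableT_comp => //; apply: measurableT_comp => //.
  exact: measurable_funM.
have F0 p : (0 <= F p)%E.
  by rewrite lee_fin !mulr_ge0 ?powR_ge0 ?expR_ge0.
have tonelli := @fubini_tonelli _ _ _ _ _ mu mu F mF F0.
rewrite hx tonelli.
under eq_integral do rewrite hy.
clear F mF F0 tonelli hx hy.
rewrite -integral_mkcond ge0_integralZr ?gamma_integral_ge0//; last 2 first.
- by apply/measurable_EFinP/measurable_funTS; exact: measurable_powR.
- by move=> y _; rewrite lee_fin powR_ge0.
by rewrite integral_powRNS// muleA -EFinM divff ?gt_eqF// mul1e.
Qed.

Lemma gamma_integral1 : gamma_integral (1 : R) 1 = 1%E.
Proof.
rewrite -[RHS](integral_exponential_pdf (@ltr01 R)) /gamma_integral.
rewrite integral_itv_obnd_cbnd//; last first.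
  by apply/measurable_EFinP; exact: measurable_gamma_integrand.
rewrite integral_mkcond; apply: eq_integral => x _.
rewrite restrict_EFin /exponential_pdf; congr EFin.
rewrite !patchE; case: ifPn => // _.
by rewrite /gamma_integrand subrr powRr0 !mul1r mulN1r.
Qed.

(** The recurrence climbs from 1 to all positive integers. At [a + 1] the exponent is positive and
    [x^a <= 1 + x^(n+1)] for [a < n + 1], which bounds the integral by two integer cases; the
    recurrence then descends to [a]. *)
Lemma gamma_integral_fin_num (a : R) : 0 < a -> gamma_integral a 1 \is a fin_num.
Proof.
move=> a0.
have finS (b : R) : 0 < b -> gamma_integral (b + 1) 1 \is a fin_num ->
    gamma_integral b 1 \is a fin_num.
  move=> b0; rewrite -gamma_integral_rec//.
  rewrite !ge0_fin_numE ?mule_ge0 ?gamma_integral_ge0 ?lee_fin ?ltW//.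
  by rewrite !ltey; apply: contraNN => /eqP ->; rewrite gt0_muley ?lte_fin.
have finn n : gamma_integral (n.+1%:R : R) 1 \is a fin_num.
  elim: n => [|n IHn]; first by rewrite gamma_integral1.
  by rewrite -addn1 natrD -gamma_integral_rec// fin_numM.
apply: finS => //; pose n := Num.truncn a.
have an : a < n.+1%:R by exact: truncnS_gt.
rewrite ge0_fin_numE ?gamma_integral_ge0//.
apply: (@le_lt_trans _ _ (gamma_integral 1 1 + gamma_integral n.+2%:R 1)%E); last first.
  by rewrite lte_add_pinfty// -ge0_fin_numE ?gamma_integral_ge0//; exact: (finn 0%N).
rewrite /gamma_integral -ge0_integralD//; last 4 first.
- by move=> x _; rewrite lee_fin gamma_integrand_ge0.
- by apply/measurable_EFinP; exact: measurable_gamma_integrand.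
- by move=> x _; rewrite lee_fin gamma_integrand_ge0.
- by apply/measurable_EFinP; exact: measurable_gamma_integrand.
apply: ge0_le_integral => //.
- by move=> x _; rewrite lee_fin gamma_integrand_ge0.
- by apply/measurable_EFinP; exact: measurable_gamma_integrand.
- by apply: emeasurable_funD; apply/measurable_EFinP; exact: measurable_gamma_integrand.
move=> x; rewrite /= in_itv/= andbT => x0.
rewrite -EFinD lee_fin /gamma_integrand -mulrDl ler_wpM2r ?expR_ge0//.
rewrite subrr powRr0 addrK (_ : n.+2%:R - 1 = n.+1%:R); last by rewrite -addn1 natrD addrK.
have [x1|/ltW x1] := leP x 1.
  rewrite (@le_trans _ _ 1)// ?lerDl ?powR_ge0//.
  have h1 : (1 : R) `^ a = 1 by rewrite powR1.
  by rewrite -[leRHS]h1; apply: (ge0_ler_powR (ltW a0)); rewrite ?nnegrE ?ler01 ?(ltW x0).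
rewrite (@le_trans _ _ (x `^ n.+1%:R))// ?lerDr//.
by apply: ler_powR => //; exact: ltW.
Qed.

Lemma fine_gamma_integral (a : R) : fine (gamma_integral a 1) = Gamma a.
Proof.
rewrite /gamma_integral /Gamma /Rintegral; congr fine; apply: eq_integral => x _.
by rewrite /gamma_integrand mul1r.
Qed.

Lemma gamma_integralE (a c : R) : 0 < a -> 0 < c ->
  gamma_integral a c = (c `^ (- a) * Gamma a)%:E.
Proof.
move=> a0 c0; rewrite gamma_integral_scale// -fine_gamma_integral EFinM fineK//.
exact: gamma_integral_fin_num.
Qed.

Lemma Gamma_rec (a : R) : 0 < a -> Gamma (a + 1) = a * Gamma a.
Proof.
move=> a0; rewrite -!fine_gamma_integral -gamma_integral_rec// fineM//.
exact: gamma_integral_fin_num.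
Qed.

Lemma integrable_gamma_integrand (a c : R) : 0 < a -> 0 < c ->
  mu.-integrable `]0, +oo[ (EFin \o gamma_integrand a c).
Proof.
move=> a0 c0; apply/integrableP; split.
  by apply/measurable_EFinP; exact: measurable_gamma_integrand.
under eq_integral do rewrite /= ger0_norm ?gamma_integrand_ge0//.
by rewrite -/(gamma_integral a c) gamma_integralE// ltry.
Qed.

(** Write [e^(-x)] as [e^(-(1+s)x) e^(s x)] in the integral for [Gamma a] and expand [e^(s x)]. All
    terms are nonnegative, so the series is integrated termwise, each term being a gamma integral of
    rate [1 + s]. *)
Lemma negative_binomial_series (a s : R) : 0 < a -> 0 <= s ->
  (\sum_(0 <= n <oo) (s ^+ n / n`!%:R * Gamma (n%:R + a) *
     (1 + s) `^ (- (n%:R + a)))%:E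
   = (Gamma a)%:E)%E.
Proof.
move=> a0 s0; have s1 : 0 < 1 + s by rewrite ltr_pwDl.
transitivity (gamma_integral a 1); last by rewrite gamma_integralE// powR1 mul1r.
have na n : 0 < n%:R + a by rewrite ltr_wpDl.
rewrite /gamma_integral.
transitivity (\sum_(0 <= n <oo) \int[mu]_(x in `]0%R, +oo[)
   (s ^+ n / n`!%:R * gamma_integrand (n%:R + a) (1 + s) x)%:E)%E.
  apply: eq_eseriesr => n _; under eq_integral do rewrite EFinM.
  rewrite ge0_integralZl//; last 3 first.
  - by apply/measurable_EFinP; exact: measurable_gamma_integrand.
  - by move=> x _; rewrite lee_fin gamma_integrand_ge0.
  - by rewrite lee_fin mulr_ge0 ?exprn_ge0.
  rewrite -/(gamma_integral _ _) gamma_integralE// -EFinM; congr EFin; ring.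
rewrite -integral_nneseries//; last 2 first.
- move=> n; apply/measurable_EFinP; apply: measurable_funM => //.
  exact: measurable_gamma_integrand.
- by move=> n x _; rewrite lee_fin mulr_ge0 ?gamma_integrand_ge0// divr_ge0 ?exprn_ge0.
apply: eq_integral => x; rewrite inE/= in_itv/= andbT => x0.
under eq_eseriesr => n _.
  rewrite (_ : _ * _ = gamma_integrand a (1 + s) x * exp_coeff (s * x) n); last first.
    rewrite /gamma_integrand /exp_coeff/= exprMn.
    rewrite -addrA (@powRD _ x n%:R) ?powR_mulrn ?(ltW x0)//; last first.
      by rewrite (gt_eqF x0) implybT.
    by ring.
  rewrite EFinM; over.
rewrite nneseriesZl//; last by move=> n _; rewrite lee_fin exp_coeff_ge0// mulr_ge0// ltW.
apply: (@etrans _ _ ((gamma_integrand a (1 + s) x)%:E * (expR (s * x))%:E)%E).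
  congr (_ * _)%E; apply/cvg_lim => //.
  rewrite (_ : (fun n => _) = EFin \o series (exp_coeff (s * x))); last first.
    by apply/funext => n /=; rewrite sumEFin.
  by apply: cvg_EFin; [exact: nearW|exact: is_cvg_series_exp_coeff].
rewrite -EFinM /gamma_integrand -mulrA -expRD; congr (_ * expR _)%:E; ring.
Qed.

End gamma.

(** * Determinants and rising and falling factorials *)

Section algebra.
Context {R : realType}.

Lemma vandermondeE n (x : 'I_n -> R) :
  vandermonde x = \det (\matrix_(i, j) x i ^+ j).
Proof.
rewrite -det_tr (_ : _^T = Vandermonde n (\row_i x i)); last first.
  by apply/matrixP => i j; rewrite !mxE.
rewrite det_Vandermonde /vandermonde.
by apply: eq_bigr => i _; apply: eq_bigr => j _; rewrite !mxE.
Qed.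

(** Passing from the monomials to monic polynomials of the same degrees is multiplication by a
    unitriangular matrix of coefficients. *)
Lemma det_monic_poly n (p : 'I_n -> {poly R}) (x : 'I_n -> R) :
  (forall j, p j \is monic) -> (forall j, size (p j) = j.+1) ->
  \det (\matrix_(i, j) (p j).[x i]) = vandermonde x.
Proof.
move=> pm ps; rewrite vandermondeE.
pose U : 'M[R]_n := \matrix_(j, k) (p j)`_k.
have -> : \matrix_(i, j) (p j).[x i] = (\matrix_(i, j) x i ^+ j) *m U^T.
  apply/matrixP => i j; rewrite !mxE (@horner_coef_wide _ n) ?ps//.
  by apply: eq_bigr => k _; rewrite !mxE mulrC.
rewrite det_mulmx det_tr [\det U]det_trig ?big1 ?mulr1// => [i _|].
  by rewrite mxE -[RHS](monicP (pm i)) lead_coefE ps.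
by apply/is_trig_mxP => i j ij; rewrite mxE nth_default// ps.
Qed.

Lemma horner_prod_XsubC_nat k (a : nat -> R) y :
  (\prod_(0 <= i < k) ('X - (a i)%:P)).[y] = \prod_(0 <= i < k) (y - a i).
Proof. by rewrite horner_prod; apply: eq_bigr => i _; rewrite hornerXsubC. Qed.

(** The nodes [a l = l] yield falling factorials, the nodes [a l = - (beta + l)] rising ones. *)
Lemma det_prod_sub n (a : nat -> R) (x : 'I_n -> R) :
  \det (\matrix_(i < n, j < n) \prod_(0 <= l < j) (x i - a l)) = vandermonde x.
Proof.
rewrite -(@det_monic_poly n (fun j => \prod_(0 <= l < j) ('X - (a l)%:P))).
- congr (\det _); apply/matrixP => i j; rewrite !mxE.
  by rewrite horner_prod_XsubC_nat.
- by move=> j; exact: monic_prod_XsubC.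
- by move=> j; rewrite size_prod_XsubC size_iota subn0.
Qed.

Lemma natr_ffact k m : (m ^_ k)%:R = \prod_(0 <= i < k) (m%:R - i%:R) :> R.
Proof.
elim: k => [|k IHk]; first by rewrite big_nil.
rewrite big_nat_recr//= ffactnSr natrM IHk.
(* For [m < k] the truncated difference [m - k] is not the real one, but the falling factorial
   before it is already 0. *)
have [km|mk] := leqP k m; first by rewrite natrB.
by rewrite -IHk ffact_small// !mul0r.
Qed.

Lemma Gamma_addn k (a : R) : 0 < a ->
  Gamma (k%:R + a) = (\prod_(0 <= i < k) (a + i%:R)) * Gamma a.
Proof.
move=> a0; elim: k => [|k IHk]; first by rewrite big_nil mul1r add0r.
rewrite big_nat_recr//= -addn1 natrD addrAC Gamma_rec; last by rewrite ltr_wpDl.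
by rewrite IHk; ring.
Qed.

Lemma sum_ord n : (\sum_(i < n) i = (n * n.-1)./2)%N.
Proof. by rewrite -bin2 -bin2_sum big_mkord. Qed.

Lemma det_mul_row n (c : 'I_n -> R) (A : 'I_n -> 'I_n -> R) :
  \det (\matrix_(i, j) (c i * A i j)) = (\prod_i c i) * \det (\matrix_(i, j) A i j).
Proof.
have -> : \matrix_(i, j) (c i * A i j) = diag_mx (\row_i c i) *m \matrix_(i, j) A i j.
  by apply/matrixP => i j; rewrite mul_diag_mx !mxE.
by rewrite det_mulmx det_diag; congr (_ * _); apply: eq_bigr => i _; rewrite mxE.
Qed.

Lemma det_mul_col n (c : 'I_n -> R) (A : 'I_n -> 'I_n -> R) :
  \det (\matrix_(i, j) (A i j * c j)) = (\prod_j c j) * \det (\matrix_(i, j) A i j).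
Proof.
rewrite -det_tr -[\det (\matrix_(i, j) A i j)]det_tr.
have -> : (\matrix_(i, j) A i j)^T = \matrix_(i, j) A j i.
  by apply/matrixP => i j; rewrite !mxE.
rewrite -det_mul_row; congr (\det _).
by apply/matrixP => i j; rewrite !mxE mulrC.
Qed.

Lemma det_tie (T : Type) n (g : 'I_n -> T -> R) (x : 'I_n -> T) :
  ~ injective x -> \det (\matrix_(i, j) g j (x i)) = 0.
Proof.
move=> xi; have [//|G0] := eqVneq (\det (\matrix_(i, j) g j (x i))) 0.
exfalso; apply: xi => i j xij.
apply/eqP; apply: contraNT G0 => ij; apply/eqP.
by apply: (determinant_alternate ij) => k; rewrite !mxE xij.
Qed.

End algebra.

(** * Permutation invariance of the Lebesgue measure on tuples *)

Section tuple_integral.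
Context {R : realType}.
Notation mu := (@lebesgue_measure R).
Notation L n := (@lebesgue_tuple R n).

Lemma ge0_integral_lebesgue_cons n (f : n.+1.-tuple R -> \bar R) :
  measurable_fun setT f -> (forall x, 0 <= f x)%E ->
  (\int[L n.+1]_x f x = \int[mu]_a \int[L n]_t f (cons_pair (a, t)))%E.
Proof.
move=> mf f0.
have mc := @measurable_cons_pair R n.
transitivity (\int[pushforward (mu \x L n)%E (@cons_pair R n)]_x f x)%E; first by [].
rewrite (ge0_integral_pushforward mc)//.
rewrite fubini_tonelli1//; first exact: measurableT_comp.
by move=> p; exact: f0.
Qed.

Definition perm_tuple (T : Type) n (s : 'S_n) (x : n.-tuple T) : n.-tuple T :=
  [tuple tnth x (s i) | i < n].

Lemma tnth_perm_tuple (T : Type) n (s : 'S_n) (x : n.-tuple T) i :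
  tnth (perm_tuple s x) i = tnth x (s i).
Proof. by rewrite tnth_mktuple. Qed.

Lemma perm_tuple1 (T : Type) n (x : n.-tuple T) : perm_tuple 1%g x = x.
Proof. by apply: eq_from_tnth => i; rewrite tnth_perm_tuple perm1. Qed.

Lemma perm_tupleM (T : Type) n (s t : 'S_n) (x : n.-tuple T) :
  perm_tuple (s * t)%g x = perm_tuple s (perm_tuple t x).
Proof. by apply: eq_from_tnth => i; rewrite !tnth_perm_tuple permM. Qed.

Lemma measurable_perm_tuple n (s : 'S_n) :
  measurable_fun setT (@perm_tuple (measurableTypeR R) n s).
Proof.
apply/measurable_fun_tnthP => i.
rewrite (_ : _ \o _ = fun x : n.-tuple (measurableTypeR R) => tnth x (s i)).
  exact: measurable_tnth.
by apply/funext => x /=; rewrite tnth_perm_tuple.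
Qed.

(** Reduces a permutation in the stabiliser of the first coordinate to one of the tail, where the
    induction on the dimension applies. *)
Lemma perm_tuple_lift n (s : 'S_n.+1) : s ord0 = ord0 ->
  exists s' : 'S_n, forall (T : Type) (a : T) (t : n.-tuple T),
    perm_tuple s [tuple of a :: t] = [tuple of a :: perm_tuple s' t].
Proof.
move=> s0.
have sl (j : 'I_n) : {k | s (lift ord0 j) = lift ord0 k}.
  have [k ->|sj] := unliftP ord0 (s (lift ord0 j)); first by exists k.
  suff : lift ord0 j = ord0 by [].
  by apply: (@perm_inj _ s); rewrite s0.
pose h j := sval (sl j).
have hE j : s (lift ord0 j) = lift ord0 (h j) by rewrite /h; case: (sl j).
have hi : injective h.
  by move=> i j hij; apply: (@lift_inj _ ord0); apply: (@perm_inj _ s); rewrite !hE hij.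
exists (perm hi) => T a t; apply: eq_from_tnth => i; rewrite tnth_perm_tuple.
have [j ->|->] := unliftP ord0 i; last by rewrite s0.
by rewrite hE !tnthS tnth_perm_tuple permE.
Qed.

(** Stated for nonnegative functions, where Tonelli permits the exchange of integrals; signed
    functions follow by positive and negative parts. *)
Definition perm_invariant n (s : 'S_n) := forall f : n.-tuple R -> \bar R,
  measurable_fun setT f -> (forall x, 0 <= f x)%E ->
  (\int[L n]_x f (perm_tuple s x) = \int[L n]_x f x)%E.

Lemma perm_invariantM n (s t : 'S_n) :
  perm_invariant s -> perm_invariant t -> perm_invariant (s * t)%g.
Proof.
move=> Is It f mf f0; rewrite -(Is f mf f0) -(It (f \o perm_tuple s)) //=.
  by apply: eq_integral => x _; rewrite perm_tupleM.
exact: (measurableT_comp mf (measurable_perm_tuple s)).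
Qed.

(** Peel off the two outer one-dimensional integrals and exchange them by Tonelli, the integral over
    the remaining coordinates being a measurable function of the first two. *)
Lemma perm_invariant_swap n : perm_invariant (tperm ord0 (lift ord0 ord0) : 'S_n.+2).
Proof.
move=> f mf f0.
pose g (p : (measurableTypeR R * measurableTypeR R) * n.-tuple R) : \bar R :=
  f (cons_pair (p.1.1, cons_pair (p.1.2, p.2))).
have mg : measurable_fun setT g.
  apply: (measurableT_comp mf).
  apply: (@measurable_cons _ _ _ _
    (fun p : (measurableTypeR R * measurableTypeR R) * n.-tuple R => p.1.1 : R)
    n.+1 (fun p => cons_pair (p.1.2, p.2))).
    exact: (measurableT_comp measurable_fst measurable_fst).
  apply: (@measurable_cons _ _ _ _
    (fun p : (measurableTypeR R * measurableTypeR R) * n.-tuple R => p.1.2 : R)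
    n snd) => //.
  exact: (measurableT_comp measurable_snd measurable_fst).
have mG : measurable_fun setT (fubini_F (L n) g).
  by apply: measurable_fun_fubini_tonelli_F => // p; exact: f0.
have E (h : n.+2.-tuple R -> \bar R) :
    measurable_fun setT h -> (forall x, 0 <= h x)%E ->
    (\int[L n.+2]_x h x =
     \int[mu]_a \int[mu]_b \int[L n]_t h (cons_pair (a, cons_pair (b, t))))%E.
  move=> mh h0; rewrite ge0_integral_lebesgue_cons//; apply: eq_integral => a _.
  rewrite ge0_integral_lebesgue_cons//.
  apply: (measurableT_comp mh).
  by apply: (@measurable_cons _ _ _ _ (cst a) n.+1 id).
rewrite E; [|exact: (measurableT_comp mf (measurable_perm_tuple _))|by move=> x; exact: f0].
rewrite (E f mf f0).
transitivity (\int[mu]_a \int[mu]_b fubini_F (L n) g (b, a))%E; last first.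
  rewrite -(@fubini_tonelli _ _ _ _ _ mu mu (fubini_F (L n) g) mG)//.
  by move=> p; apply: integral_ge0 => t _; exact: f0.
apply: eq_integral => a _; apply: eq_integral => b _; apply: eq_integral => t _.
rewrite /g /=; congr f; apply: eq_from_tnth => i; rewrite tnth_perm_tuple.
have [j ->|->] := unliftP ord0 i; last by rewrite tpermL.
have [k ->|->] := unliftP ord0 j; last by rewrite tpermR.
by rewrite tpermD// /cons_pair/= !tnthS.
Qed.

(* The symmetric group is generated by the stabiliser of the first coordinate and
   the transposition of the first two. *)
Lemma perm_invariant_all n (s : 'S_n) : perm_invariant s.
Proof.
elim: n s => [|n IHn] s.
  by move=> f _ _; apply: eq_integral => x _; congr f; apply: eq_from_tnth => -[].
have stab (u : 'S_n.+1) : u ord0 = ord0 -> perm_invariant u.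
  move=> /perm_tuple_lift[u' uE] f mf f0.
  apply: etrans.
    exact: (ge0_integral_lebesgue_cons
      (measurableT_comp mf (measurable_perm_tuple u)) (fun x => f0 _)).
  rewrite (ge0_integral_lebesgue_cons mf f0).
  apply: eq_integral => a _.
  rewrite -(IHn u' (fun t => f (cons_pair (a, t)))).
  - by apply: eq_integral => t _; rewrite /cons_pair/= uE.
  - apply: (measurableT_comp mf).
    by apply: (@measurable_cons _ _ _ _ (cst a) n id).
  - by move=> t; exact: f0.
have [/stab//|s0] := eqVneq (s ord0) ord0.
case: n => [|n] in s IHn stab s0 *; first by rewrite (ord1 (s ord0)) eqxx in s0.
(* [u] fixes [ord0], since neither [s ord0] nor [o1] equals it. So does [s * u * tperm ord0 o1],
   which carries [ord0] to [s ord0], then to [o1], then back. *)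
pose o1 : 'I_n.+2 := lift ord0 ord0; pose u := tperm (s ord0) o1.
have Iu : perm_invariant u by apply: stab; rewrite tpermD// eq_sym.
have -> : s = (s * u * tperm ord0 o1 * tperm ord0 o1 * u)%g.
  by rewrite -(mulgA (s * u)%g) tperm2 mulg1 -mulgA /u tperm2 mulg1.
apply: (perm_invariantM _ Iu); apply: perm_invariantM (@perm_invariant_swap n).
by apply: stab; rewrite !permM tpermL tpermR.
Qed.

Lemma integral_perm_tuple n (s : 'S_n) (f : n.-tuple R -> \bar R) :
  measurable_fun setT f ->
  (\int[L n]_x f (perm_tuple s x) = \int[L n]_x f x)%E.
Proof.
move=> mf; rewrite [LHS]integralE [RHS]integralE; congr (_ - _)%E.
- rewrite -(perm_invariant_all s (measurable_funepos mf) (funepos_ge0 f)).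
  by apply: eq_integral => x _; rewrite (funepos_comp f (perm_tuple s)).
- rewrite -(perm_invariant_all s (measurable_funeneg mf) (funeneg_ge0 f)).
  by apply: eq_integral => x _; rewrite (funeneg_comp f (perm_tuple s)).
Qed.

Lemma integrable_perm_tuple n (s : 'S_n) (f : n.-tuple R -> \bar R) :
  (L n).-integrable setT f -> (L n).-integrable setT (f \o perm_tuple s).
Proof.
move=> /integrableP[mf fi]; apply/integrableP; split.
  exact: (measurableT_comp mf (measurable_perm_tuple s)).
by rewrite (@integral_perm_tuple _ s (abse \o f))//; exact: measurableT_comp.
Qed.

End tuple_integral.

(** * The Andreief identity *)

Section andreief.
Context {R : realType}.
Notation mu := (@lebesgue_measure R).
Notation L n := (@lebesgue_tuple R n).

Let measurable_tuple_prod n (f : 'I_n -> R -> R) :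
  (forall i, measurable_fun setT (f i)) ->
  measurable_fun setT (fun x : n.-tuple R => \prod_(i < n) f i (tnth x i)).
Proof.
move=> mf; apply: measurable_prod => i _.
exact: (measurableT_comp (mf i) (measurable_tnth i)).
Qed.

(** Fubini by induction on [n]. Integrability is part of the induction, because the inner integrals
    of signed functions call for it. *)
Lemma integral_lebesgue_tuple_prod n (f : 'I_n -> R -> R) :
  (forall i, mu.-integrable setT (EFin \o f i)) ->
  (L n).-integrable setT (fun x => (\prod_(i < n) f i (tnth x i))%:E) /\
  (\int[L n]_x (\prod_(i < n) f i (tnth x i))%:E =
   (\prod_(i < n) \int[mu]_x f i x)%:E)%E.
Proof.
elim: n f => [|n IHn] f fi.
  split.
    apply/integrableP; split.
      rewrite (_ : (fun _ => _) = cst 1%E); first exact: measurable_cst.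
      by apply/funext => x; rewrite big_ord0.
    under eq_integral do rewrite big_ord0 abse1.
    by rewrite integral_cst//= diracT mule1 ltry.
  under eq_integral do rewrite big_ord0.
  by rewrite integral_cst//= diracT mule1 big_ord0.
have mf i : measurable_fun setT (f i).
  by have /integrableP[/measurable_EFinP] := fi i.
have [gi gE] := IHn (fun i => f (lift ord0 i)) (fun i => fi _).
set g := fun t : n.-tuple R => \prod_(i < n) f (lift ord0 i) (tnth t i).
have FE (p : measurableTypeR R * n.-tuple R) :
    (\prod_(i < n.+1) f i (tnth (cons_pair p) i)) = f ord0 p.1 * g p.2.
  rewrite big_ord_recl; congr (_ * _); apply: eq_bigr => i _.
  by rewrite /cons_pair tnthS.
have mF : measurable_fun setT
    (fun x : n.+1.-tuple R => (\prod_(i < n.+1) f i (tnth x i))%:E).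
  by apply/measurable_EFinP; exact: measurable_tuple_prod.
have mc := @measurable_cons_pair R n.
have iP : (mu \x L n)%E.-integrable setT
    ((fun x : n.+1.-tuple R => (\prod_(i < n.+1) f i (tnth x i))%:E) \o
     @cons_pair R n).
  apply/integrable12ltyP; first exact: (measurableT_comp mF mc).
  rewrite (_ : (\int[_]_x _)%E =
      (\int[mu]_x `|(f ord0 x)%:E| * \int[L n]_t `|(g t)%:E|)%E).
    have /integrableP[_ f0i] := fi ord0; have /integrableP[_ gii] := gi.
    by rewrite lte_mul_pinfty ?integral_ge0// ge0_fin_numE ?integral_ge0.
  rewrite -ge0_integralZr ?integral_ge0//; last first.
    have /integrableP[m0 _] := fi ord0.
    by apply: (measurableT_comp _ m0).
  apply: eq_integral => x _.
  rewrite -ge0_integralZl//; last first.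
    have /integrableP[m0 _] := gi.
    by apply: (measurableT_comp _ m0).
  by apply: eq_integral => t _; rewrite /= FE/= normrM EFinM.
have iF : (L n.+1).-integrable setT (fun x => (\prod_(i < n.+1) f i (tnth x i))%:E).
  exact: (integrable_pushforward mc mF iP).
split => //.
transitivity (\int[pushforward (mu \x L n)%E (@cons_pair R n)]_x
  (\prod_(i < n.+1) f i (tnth x i))%:E)%E; first by [].
rewrite (integral_pushforward mc mF iP)// -integral12_prod_meas1//.
rewrite /fubini_F/=.
transitivity (\int[mu]_x ((f ord0 x)%:E *
  (\prod_(i < n) \int[mu]_x f (lift ord0 i) x)%:E))%E.
  apply: eq_integral => x _; rewrite -gE -integralZl//.
  by apply: eq_integral => t _; rewrite FE EFinM.
rewrite (integralZr measurableT (fi ord0)).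
rewrite [in RHS]big_ord_recl EFinM; congr (_ * _)%E.
by rewrite /Rintegral fineK//; exact: (integrable_fin_num measurableT (fi ord0)).
Qed.

Lemma tuple_ltP n (x : n.-tuple R) :
  reflect (forall i j : 'I_n, (i < j)%N -> tnth x i < tnth x j) (sorted <%R x).
Proof.
apply: (iffP idP) => [sx i j ij|h].
  by rewrite !(tnth_nth 0); rewrite (lt_sorted_ltn_nth 0 sx) ?inE ?size_tuple.
apply/(sortedP 0) => i; rewrite size_tuple => iS.
have iS' := ltnW iS.
by have := h (Ordinal iS') (Ordinal iS) (ltnSn i); rewrite !(tnth_nth 0).
Qed.

Lemma measurable_sorted n : measurable [set x : n.-tuple R | sorted <%R x].
Proof.
rewrite (_ : [set x : n.-tuple R | _] =
    \bigcap_(i in [set: 'I_n]) \bigcap_(j in [set j : 'I_n | (i < j)%N])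
      [set x | tnth x i < tnth x j]); last first.
  apply/seteqP; split=> x /= h; first by move=> i _ j ij; move/tuple_ltP: h; exact.
  by apply/tuple_ltP => i j ij; exact: (h i I j ij).
apply: fin_bigcap_measurable => // i _.
apply: fin_bigcap_measurable => // j _.
rewrite (_ : [set x | _] = ~` [set x | tnth x j <= tnth x i]); last first.
  by apply/seteqP; split=> x /=; rewrite ltNge => /negP.
apply: measurableC; rewrite -[X in measurable X]setTI.
by apply: measurable_fun_le => //; exact: measurable_tnth.
Qed.

(** Exactly one permutation sorts distinct coordinates: sorting provides one, and two strictly
    increasing rearrangements of the same elements coincide. *)
Lemma sum_sorted_perm n (x : n.-tuple R) : injective (tnth x) ->
  \sum_(s : 'S_n) (sorted <%R (perm_tuple s x))%:R = 1 :> R.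
Proof.
move=> xi.
have ux : uniq x by rewrite -map_tnth_enum map_inj_uniq ?enum_uniq.
have pe (s : 'S_n) : perm_eq (perm_tuple s x) x.
  by apply/tuple_permP; exists s.
have /tuple_permP[s0 s0E] : perm_eq (sort <=%R x) x by rewrite perm_sort.
have {}s0E : sort <=%R x = perm_tuple s0 x by [].
have ss0 : sorted <%R (perm_tuple s0 x) by rewrite -s0E sort_lt_sorted.
rewrite (bigD1 s0)//= ss0 big1 ?addr0// => s ss0n.
case: (boolP (sorted _ _)) => // ss.
have E : perm_tuple s x = perm_tuple s0 x.
  apply: val_inj; apply: lt_sorted_eq => // z.
  by rewrite (perm_mem (pe s)) (perm_mem (pe s0)).
case/negP: ss0n; apply/eqP/permP => i; apply: xi.
by rewrite -!tnth_perm_tuple E.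
Qed.

(* Expanding the first determinant turns the integrand into the sum of the
   translates of [H] by all permutations; as [H] vanishes on ties, summing over
   the chambers gives the integral of [H] over the whole space. *)
Lemma andreief n (f g : 'I_n -> R -> R) :
  (forall i j, mu.-integrable setT (EFin \o (fun x => f i x * g j x))) ->
  let F := fun x : n.-tuple R => \det (\matrix_(i, j) f j (tnth x i)) *
                                 \det (\matrix_(i, j) g j (tnth x i)) in
  (L n).-integrable setT (EFin \o F) /\
  (\int[L n]_(x in [set x : n.-tuple R | sorted <%R x]) (F x)%:E =
   (\det (\matrix_(i, j) \int[mu]_x (f i x * g j x)))%:E)%E.
Proof.
move=> fg F.
pose G (x : n.-tuple R) := \matrix_(i, j) g j (tnth x i).
pose H (x : n.-tuple R) := (\prod_(i < n) f i (tnth x i)) * \det (G x).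
have Gs s x : \det (G (perm_tuple s x)) = (-1) ^+ s * \det (G x).
  rewrite -det_perm -det_mulmx -row_permE; congr (\det _).
  by apply/matrixP => i j; rewrite !mxE tnth_perm_tuple.
have G0 x : ~ injective (tnth x) -> \det (G x) = 0 by exact: det_tie.
have HE x : H x = \sum_(u : 'S_n)
    (-1) ^+ u * \prod_(i < n) (f i (tnth x i) * g (u i) (tnth x i)).
  rewrite /H mulr_sumr; apply: eq_bigr => u _.
  rewrite big_split/= mulrCA; congr (_ * (_ * _)).
  by apply: eq_bigr => i _; rewrite mxE.
have FE x : F x = \sum_(s : 'S_n) H (perm_tuple s x).
  rewrite /F -det_tr mulr_suml; apply: eq_bigr => s _.
  rewrite /H Gs mulrCA mulrA; congr (_ * _ * _).
  by apply: eq_bigr => i _; rewrite !mxE tnth_perm_tuple.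
have prodP (u : 'S_n) := integral_lebesgue_tuple_prod
  (f := fun i x => f i x * g (u i) x) (fun i => fg i (u i)).
have iH : (L n).-integrable setT (EFin \o H).
  rewrite (_ : EFin \o H = fun x => (\sum_(u : 'S_n) ((-1) ^+ u)%:E *
      (\prod_(i < n) (f i (tnth x i) * g (u i) (tnth x i)))%:E)%E); last first.
    by apply/funext => x /=; rewrite HE -sumEFin.
  apply: integrable_sum => // u _.
  by apply: integrableZl => //; exact: (prodP u).1.
have iHs s := integrable_perm_tuple s iH.
have iF : (L n).-integrable setT (EFin \o F).
  rewrite (_ : EFin \o F =
      fun x => (\sum_(s : 'S_n) ((EFin \o H) \o perm_tuple s) x)%E); last first.
    by apply/funext => x /=; rewrite FE -sumEFin.
  exact: integrable_sum.
split => //.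
have mS := @measurable_sorted n.
pose chi (x : n.-tuple R) : R := (sorted <%R x)%:R.
have mchi : measurable_fun setT chi.
  rewrite (_ : chi = \1_[set x : n.-tuple R | sorted <%R x]); first exact: measurable_indic.
  by apply/funext => x; rewrite indicE mem_setE.
have iHc s : (L n).-integrable setT (fun x => (H x * chi (perm_tuple s x))%:E).
  apply: (le_integrable measurableT _ _ iH).
    apply/measurable_EFinP; apply: measurable_funM.
      by have /integrableP[/measurable_EFinP] := iH.
    exact: (measurableT_comp mchi (measurable_perm_tuple s)).
  move=> x _; rewrite lee_fin normrM /chi; case: sorted; first by rewrite normr1 mulr1.
  by rewrite normr0 mulr0.
transitivity (\int[L n]_x (\sum_(s : 'S_n) (H (perm_tuple s x) * chi x)%:E))%E.
  rewrite integral_mkcond; apply: eq_integral => x _.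
  rewrite patchE /chi sumEFin -mulr_suml -FE.
  have [sx|/negP sx] := boolP (sorted <%R x); first by rewrite mem_set// mulr1.
  by rewrite memNset// mulr0.
rewrite integral_sum//; last first.
  move=> s; have := integrable_perm_tuple s (iHc s^-1%g).
  apply: eq_integrable => // x _.
  by rewrite /= -perm_tupleM mulVg perm_tuple1.
(* A change of variables moves the permutation from [H] to the indicator of the chamber, so that [H]
   becomes a common factor. *)
transitivity (\sum_(s : 'S_n) \int[L n]_x (H x * chi (perm_tuple s^-1%g x))%:E)%E.
  apply: eq_bigr => s _.
  have /integrableP[m _] := iHc s^-1%g.
  rewrite -(integral_perm_tuple s m).
  by apply: eq_integral => x _; rewrite -perm_tupleM mulVg perm_tuple1.
rewrite -integral_sum//.
transitivity (\int[L n]_x (H x)%:E)%E.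
  apply: eq_integral => x _; rewrite sumEFin -mulr_sumr; congr EFin.
  have [xi|/G0 Gx0] := pselect (injective (tnth x)); last by rewrite /H Gx0 mulr0 mul0r.
  rewrite -[RHS]mulr1 -(sum_sorted_perm xi); congr (_ * _).
  by rewrite [RHS](reindex_inj invg_inj).
under eq_integral do rewrite HE -sumEFin.
rewrite integral_sum//; last first.
  by move=> u; under eq_fun do rewrite EFinM; apply: integrableZl => //; exact: (prodP u).1.
rewrite /determinant -sumEFin; apply: eq_bigr => u _.
under eq_integral do rewrite EFinM.
rewrite integralZl//; last exact: (prodP u).1.
rewrite (prodP u).2 -EFinM; congr (_ * _)%:E.
by apply: eq_bigr => i _; rewrite mxE.
Qed.

End andreief.

(** * The Andreief identity on the Weyl chamber of the half-line *)

Section weyl_andreief.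
Context {R : realType}.
Notation mu := (@lebesgue_measure R).
Notation L n := (@lebesgue_tuple R n).

Lemma weyl_c_sorted n (x : n.-tuple R) :
  weyl_c n x -> injective (tnth x) -> sorted <%R x.
Proof.
move=> [_ xS] xi; apply/tuple_ltP => i j ij; rewrite lt_neqAle xS ?(ltnW ij)// andbT.
by apply: contraTneq ij => /xi ->; rewrite ltnn.
Qed.

Lemma sorted_injective n (x : n.-tuple R) : sorted <%R x -> injective (tnth x).
Proof.
move=> /tuple_ltP xS i j xij; apply: val_inj => /=.
by case: (ltngtP i j) => // /xS; rewrite xij ltxx.
Qed.

Lemma sorted_weyl_c n (x : n.-tuple R) :
  sorted <%R x -> (forall i, 0 <= tnth x i) -> weyl_c n x.
Proof.
move=> /tuple_ltP xS x0; split => // i j; rewrite leq_eqVlt => /orP[/eqP ij|/xS/ltW//].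
by rewrite (val_inj ij).
Qed.

(** Cutting the [g j] off outside the half-line puts a zero row in their determinant as soon as a
    coordinate is negative. The chamber and the strictly sorted nonnegative tuples then differ only
    by ties, on which the determinants vanish. *)
Lemma weyl_andreief n (f g : 'I_n -> R -> R) :
  (forall i j, mu.-integrable `[0, +oo[ (EFin \o (fun x => f i x * g j x))) ->
  let F := fun x : n.-tuple R => \det (\matrix_(i, j) f j (tnth x i)) *
                                 \det (\matrix_(i, j) g j (tnth x i)) in
  (L n).-integrable (weyl_c n) (EFin \o F) /\
  (\int[L n]_(x in weyl_c n) (F x)%:E =
   (\det (\matrix_(i, j) \int[mu]_(x in `[0, +oo[) (f i x * g j x)))%:E)%E.
Proof.
move=> fg F.
pose g' j := g j \_ `[0, +oo[.
have fgE i j x : f i x * g' j x = ((fun x => f i x * g j x) \_ `[0, +oo[) x.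
  by rewrite /g' !patchE; case: ifP; rewrite // mulr0.
have fg' i j : mu.-integrable setT (EFin \o (fun x => f i x * g' j x)).
  rewrite (_ : EFin \o _ = (EFin \o (fun x => f i x * g j x)) \_ `[0, +oo[).
    have mD : measurable (`[0%R, +oo[%classic : set (measurableTypeR R)).
      exact: measurable_itv.
    exact: (@integrable_mkcond _ _ _ mu _ (EFin \o (fun x => f i x * g j x)) mD).1.
  by apply/funext => x /=; rewrite fgE restrict_EFin.
have [iF' intF'] := andreief fg'.
set F' := (fun x : n.-tuple R => \det (\matrix_(i, j) f j (tnth x i)) *
  \det (\matrix_(i, j) g' j (tnth x i))) in iF' intF'.
have FF' : (EFin \o F) \_ (weyl_c n) =
    (EFin \o F') \_ [set x : n.-tuple R | sorted <%R x].
  apply/funext => x; rewrite !patchE.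
  have [W|W] := pselect (weyl_c n x); last first.
    rewrite memNset//; have [S|/negP S] := boolP (sorted <%R x); last by rewrite memNset.
    rewrite mem_set//= /F'.
    have [i xi] : exists i, tnth x i < 0.
      apply: contrapT => h; apply: W; apply: sorted_weyl_c => // i.
      by rewrite leNgt; apply/negP => xi; apply: h; exists i.
    rewrite (expand_det_row (\matrix_(i, j) g' j (tnth x i)) i) big1 ?mulr0// => j _.
    by rewrite !mxE /g' patchE mem_setE in_itv/= leNgt xi mul0r.
  rewrite mem_set//; have [S|/negP S] := boolP (sorted <%R x).
    rewrite mem_set//= /F /F'; congr (_ * \det _)%:E; apply/matrixP => i j.
    by rewrite !mxE /g' patchE mem_setE in_itv/= andbT W.1.
  rewrite [in RHS]memNset//= /F det_tie ?mul0r// => xi; apply: S; exact: weyl_c_sorted.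
split.
  apply: (integrable_mkcond (EFin \o F) (@measurable_weyl_c R n)).2; rewrite FF'.
  apply: (integrable_mkcond (EFin \o F') (@measurable_sorted R n)).1.
  exact: (integrableS measurableT (@measurable_sorted R n) _ iF').
rewrite integral_mkcond FF' -integral_mkcond intF'.
congr (\det _)%:E; apply/matrixP => i j; rewrite !mxE.
rewrite [RHS]Rintegral_mkcond; apply: eq_Rintegral => x _; exact: fgE.
Qed.

End weyl_andreief.

(** * Sums as integrals of functions of the integer parts *)

Section truncn.
Context {R : realType}.
Notation mu := (@lebesgue_measure R).
Notation L n := (@lebesgue_tuple R n).

Lemma measurable_truncn (K : nat -> R) :
  measurable_fun setT (fun x : R => K (Num.truncn x)).
Proof.
move=> _ Y mY; rewrite setTI.
have mt m : measurable [set x : R | Num.truncn x = m].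
  (* [Num.truncn] is 0 on negative reals, so the fibre over 0 is unbounded below. *)
  case: m => [|m].
    rewrite (_ : [set x | _] = `]-oo, 1[%classic); first exact: measurable_itv.
    apply/seteqP; split => x /=; rewrite in_itv/= -(truncn_le_nat x 0) leqn0.
      by move=> ->.
    by move/eqP.
  rewrite (_ : [set x | _] = `[m.+1%:R, m.+2%:R[%classic); first exact: measurable_itv.
  apply/seteqP; split => x /=; rewrite in_itv/= -truncn_gt_nat -truncn_le_nat.
    by move=> ->; apply/andP; split.
  by move=> h; apply/eqP; rewrite eqn_leq andbC.
rewrite (_ : _ @^-1` _ =
    \bigcup_(m in [set m | Y (K m)]) [set x | Num.truncn x = m]); last first.
  by apply/seteqP; split => x /=; [move=> Yx; exists (Num.truncn x)|move=> [m Ym /= ->]].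
exact: bigcup_measurable.
Qed.

(** The half-line is cut into intervals of unit length on which the integrand is constant. *)
Lemma ge0_integral_truncn (K : nat -> \bar R) : (forall m, 0 <= K m)%E ->
  (\int[mu]_(x in `[0%R, +oo[) K (Num.truncn x) = \sum_(0 <= m <oo) K m)%E.
Proof.
move=> K0.
pose A (m : nat) : set R := `[m%:R, m.+1%:R[%classic.
have Atr m x : A m x -> Num.truncn x = m.
  rewrite /A/= in_itv/= => /andP[mx xm]; apply/eqP; rewrite eqn_leq -ltnS.
  by rewrite truncn_lt_nat ?(le_trans _ mx)// xm truncn_ge_nat// (le_trans _ mx).
have -> : `[0%R, +oo[%classic = \bigcup_m A m.
  apply/seteqP; split => x /=; rewrite in_itv/= andbT.
    by move=> x0; exists (Num.truncn x) => //; rewrite /A/= in_itv/=; exact: truncn_itv.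
  by move=> [m _]; rewrite /A/= in_itv/= => /andP[mx _]; rewrite (le_trans _ mx).
have Kcst m : {in A m, (fun x => K (Num.truncn x)) =1 cst (K m)}.
  by move=> x; rewrite inE => /Atr /= ->.
rewrite ge0_integral_bigcup//.
- apply: eq_eseriesr => m _.
  rewrite (_ : (\int[mu]_(x in A m) _ = \int[mu]_(x in A m) cst (K m) x)%E); last first.
    by apply: eq_integral => x; exact: Kcst.
  rewrite integral_cst//; last exact: measurable_itv.
  rewrite [X in (_ * X)%E](_ : _ = 1%E) ?mule1//.
  apply: etrans; first exact: lebesgue_measure_itv.
  by rewrite /= lte_fin ltr_nat ltnSn -EFinB -natrB// subSnn.
- by move=> m; exact: measurable_itv.
- apply/measurable_fun_bigcup => [m|m]; first exact: measurable_itv.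
  apply: (eq_measurable_fun (cst (K m))) => // x xA. by rewrite (Kcst m x xA).
- apply/trivIsetP => i j _ _ ij; apply/seteqP; split => // x [/Atr xi /Atr xj].
  by move: ij; rewrite -xi -xj eqxx.
Qed.

Lemma esum_tuple_cons n (H : n.+1.-tuple nat -> \bar R) : (forall y, 0 <= H y)%E ->
  (\esum_(y in [set: n.+1.-tuple nat]) H y =
   \esum_(m in [set: nat]) \esum_(y in [set: n.-tuple nat]) H [tuple of m :: y])%E.
Proof.
move=> H0; rewrite esum_esum//.
rewrite (reindex_esum [set: nat * n.-tuple nat] _ (fun p => [tuple of p.1 :: p.2]))//.
  by congr esum; apply/seteqP; split.
split=> //.
- move=> [m y] [m' y'] _ _ /(congr1 val)/= [-> yy'].
  by congr (_, _); exact: val_inj.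
- move=> y _; exists (thead y, [tuple of behead y]) => //.
  by rewrite /= -tuple_eta.
Qed.

Definition map_truncn n (x : n.-tuple R) : n.-tuple nat :=
  [tuple of map (@Num.truncn R) x].

(* Makes the Andreief identity for integrals applicable to sums over lattice
   points. *)
Lemma ge0_integral_map_truncn n (H : n.-tuple nat -> R) : (forall y, 0 <= H y) ->
  measurable_fun setT (fun x : n.-tuple R => H (map_truncn x)) ->
  (\int[L n]_x (if all (>= 0%R) x then (H (map_truncn x))%:E else 0) =
   \esum_(y in [set: n.-tuple nat]) (H y)%:E)%E.
Proof.
elim: n H => [|n IHn] H H0 mH.
  rewrite (eq_integral (cst (H [tuple])%:E)); last first.
    by move=> x _; rewrite tuple0 /= ; congr (H _)%:E; apply: val_inj.
  rewrite integral_cst//= diracT mule1.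
  rewrite (_ : [set: 0.-tuple nat] = [set [tuple]]) ?esum_set1 ?lee_fin//.
  by apply/seteqP; split => // y _; exact: tuple0.
have mall (k : nat) : measurable [set x : k.-tuple R | all (>= 0%R) x].
  rewrite (_ : [set x : k.-tuple R | _] =
      \bigcap_(i in [set: 'I_k]) [set x | 0 <= tnth x i]).
    apply: fin_bigcap_measurable => // i _.
    rewrite -[X in measurable X]setTI; apply: measurable_fun_le => //.
    exact: measurable_tnth.
  apply/seteqP; split => x /=; first by move=> /all_tnthP h i _; exact: h.
  by move=> h; apply/all_tnthP => i; exact: h.
have mF : measurable_fun setT (fun x : n.+1.-tuple R =>
    if all (>= 0%R) x then (H (map_truncn x))%:E else 0%E).
  rewrite (_ : (fun x => _) =
      (EFin \o (fun x : n.+1.-tuple R => H (map_truncn x))) \_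
      [set x : n.+1.-tuple R | all (>= 0%R) x]).
    by apply/(measurable_restrictT _ (mall _)); exact/measurable_EFinP/measurable_funTS.
  by apply/funext => x; rewrite patchE mem_setE.
rewrite ge0_integral_lebesgue_cons//; last by move=> x; case: ifP; rewrite ?lee_fin.
rewrite esum_tuple_cons//.
rewrite -nneseries_esumT//; last by move=> m; apply: esum_ge0 => y _; rewrite lee_fin.
rewrite -ge0_integral_truncn; last by move=> m; apply: esum_ge0 => y _; rewrite lee_fin.
rewrite [RHS]integral_mkcond; apply: eq_integral => a _.
rewrite patchE mem_setE in_itv/= andbT.
case: ifPn => a0; last by rewrite integral0_eq// => t _; rewrite /= (negPf a0).
rewrite -IHn.
- apply: eq_integral => t _; rewrite /=; case: ifP => // _.
  by congr (H _)%:E; apply: val_inj.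
- by move=> y; exact: H0.
- have mc : measurable_fun setT (fun t : n.-tuple R => cons_pair (a, t)).
    by apply: (@measurable_cons _ _ _ _ (cst a) n id).
  rewrite (_ : (fun x => _) = (fun x => H (map_truncn x)) \o
      (fun t : n.-tuple R => cons_pair (a, t))).
    exact: (measurableT_comp mH mc).
  by apply/funext => t /=; congr H; apply: val_inj.
Qed.

End truncn.

(** * Measures with a density *)

Section density.
Context d (T : measurableType d) (R : realType).
Local Open Scope ereal_scope.
Import HBNNSimple.

(* [f] need not be measurable: this disposes of the values of [Lambda] on ties,
   which are limits, without showing that they depend measurably on the point. *)
Lemma ge0_integral_null_patch (m : {measure set T -> \bar R}) (f : T -> \bar R)
    (E : set T) :
  (forall x, 0 <= f x) -> measurable E -> m E = 0 ->
  \int[m]_x f x = \int[m]_x (f \_ (~` E)) x.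
Proof.
move=> f0 mE E0.
have fE0 x : 0 <= (f \_ (~` E)) x by rewrite patchE; case: ifPn.
rewrite !ge0_integralTE//; apply/eqP; rewrite eq_le; apply/andP; split.
  (* A simple function below [f], set to 0 on the null set [E], lies below the patched function and
     keeps its integral. The converse inequality is monotonicity. *)
  apply: ge_ereal_sup => _ [h /= hf <-]; apply: ereal_sup_ubound => /=.
  exists (proj_nnsfun h (measurableC mE)) => [x|].
    rewrite -mrestrict !patchE; case: ifPn => _; [exact: hf|exact: lexx].
  rewrite -!integralT_nnsfun -mrestrict.
  rewrite [RHS](ge0_negligible_integral mE)//.
  - by rewrite setTD [RHS]integral_mkcond; apply: eq_integral => x _; rewrite restrict_EFin.
  - exact/measurable_EFinP.
  - by move=> x _; rewrite lee_fin.
apply: ge_ereal_sup => _ [h /= hf <-]; apply: ereal_sup_ubound => /=; exists h => // x.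
by rewrite (le_trans (hf x))// patchE; case: ifPn => // _; exact: f0.
Qed.

Lemma integral_null_patch (m : {measure set T -> \bar R}) (f : T -> \bar R)
    (E : set T) :
  measurable E -> m E = 0 ->
  \int[m]_x f x = \int[m]_x (f \_ (~` E)) x.
Proof.
move=> mE E0; rewrite integralE [RHS]integralE; congr (_ - _).
- rewrite (ge0_integral_null_patch _ mE E0)//.
  by apply: eq_integral => x _; rewrite funepos_restrict.
- rewrite (ge0_integral_null_patch _ mE E0)//.
  by apply: eq_integral => x _; rewrite funeneg_restrict.
Qed.

Variables (m mu : {measure set T -> \bar R}) (rho : T -> R).
Hypotheses (mrho : measurable_fun setT rho) (rho0 : forall x, (0 <= rho x)%R).
Hypothesis mE : forall A, measurable A -> m A = \int[mu]_(x in A) (rho x)%:E.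

Lemma nnsfun_integral_density (h : {nnsfun T >-> R}) :
  \int[m]_x (h x)%:E = \int[mu]_x ((h x)%:E * (rho x)%:E).
Proof.
rewrite integralT_nnsfun sintegralE.
under [RHS]eq_integral => x _.
  rewrite (fimfunE h x) -fsumEFin// ge0_mule_fsuml; last first.
    by move=> y; exact: nnfun_muleindic_ge0.
  over.
rewrite ge0_integral_fsum//=; last 2 first.
- move=> r; apply: emeasurable_funM; last exact/measurable_EFinP.
  by apply/measurable_EFinP; exact: measurable_funM.
- by move=> r x _; rewrite mule_ge0 ?lee_fin//; exact: nnfun_muleindic_ge0.
apply: eq_fsbigr => r rh.
under eq_integral do rewrite EFinM -muleA.
rewrite ge0_integralZl//; last 3 first.
- apply: emeasurable_funM; exact/measurable_EFinP.
- by move=> x _; rewrite mule_ge0 ?lee_fin.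
- by move: rh; rewrite inE => -[t _ <-]; rewrite lee_fin.
rewrite mE//; congr (_ * _).
rewrite integral_mkcond; apply: eq_integral => x _.
by rewrite patchE indicE; case: ifPn => _; rewrite ?mul1e ?mul0e.
Qed.

(** Monotone convergence along simple approximations of [f], on both sides. *)
Lemma ge0_integral_density (f : T -> \bar R) :
  measurable_fun setT f -> (forall x, 0 <= f x) ->
  \int[m]_x f x = \int[mu]_x (f x * (rho x)%:E).
Proof.
move=> mf f0.
pose h := nnsfun_approx measurableT mf.
have hf x : (EFin \o h ^~ x) n @[n --> \oo] --> f x by exact: cvg_nnsfun_approx.
have ndh x : {homo (fun n => (h n x)%:E) : a b / (a <= b)%N >-> a <= b}.
  by move=> a b ab; rewrite lee_fin; exact/lefP/nd_nnsfun_approx.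
transitivity (limn (fun n => \int[m]_x (h n x)%:E)).
  rewrite -monotone_convergence//.
  - by apply: eq_integral => x _; apply/esym/cvg_lim => //; exact: hf.
  - by move=> n; exact/measurable_EFinP.
  - by move=> n x _; rewrite lee_fin.
transitivity (limn (fun n => \int[mu]_x ((h n x)%:E * (rho x)%:E))); last first.
  rewrite -monotone_convergence//.
  - apply: eq_integral => x _; apply/cvg_lim => //.
    by apply: cvgeZr => //; exact: hf.
  - by move=> n; apply: emeasurable_funM; exact/measurable_EFinP.
  - by move=> n x _; rewrite mule_ge0 ?lee_fin.
  - by move=> x _ a b ab; rewrite lee_wpmul2r ?lee_fin//; exact/lefP/nd_nnsfun_approx.
by under eq_fun do rewrite nnsfun_integral_density.
Qed.

(** Multiplication by the nonnegative [rho] commutes with taking positive and negative parts. *)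
Lemma integral_density (g : T -> R) : measurable_fun setT g ->
  \int[m]_x (g x)%:E = \int[mu]_x (g x * rho x)%:E.
Proof.
move=> mg; rewrite integralE [RHS]integralE; congr (_ - _).
- rewrite ge0_integral_density; last 2 first.
  + by apply: measurable_funepos; exact/measurable_EFinP.
  + by move=> x; exact: funepos_ge0.
  apply: eq_integral => x _; rewrite !funeposE -!EFin_max -EFinM; congr EFin.
  by rewrite maxr_pMl// mul0r.
- rewrite ge0_integral_density; last 2 first.
  + by apply: measurable_funeneg; exact/measurable_EFinP.
  + by move=> x; exact: funeneg_ge0.
  apply: eq_integral => x _; rewrite !funenegE -!EFinN -!EFin_max -EFinM; congr EFin.
  by rewrite maxr_pMl// mul0r mulNr.
Qed.

End density.

(** * The Laguerre and Meixner ensembles *)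

Section ensembles.
Context {R : realType}.
Notation mu := (@lebesgue_measure R).
Notation L n := (@lebesgue_tuple R n).
Variables (sigma beta : R) (N : nat).
Hypotheses (sigma_gt0 : 0 < sigma) (beta_gt0 : 0 < beta).

Let sigma1_gt0 : 0 < 1 + sigma.
Proof. by rewrite addr_gt0. Qed.

Let naddb (n : nat) : 0 < n%:R + beta.
Proof. by rewrite ltr_wpDl. Qed.

Definition gamma_weight (x : R) : R := (Gamma beta)^-1 * x `^ (beta - 1) * expR (- x).

Lemma gamma_integrand_monomial (c b x : R) (k : nat) : 0 < x ->
  x ^+ k * gamma_integrand b c x = gamma_integrand (k%:R + b) c x.
Proof.
move=> x0; rewrite /gamma_integrand mulrA; congr (_ * _).
by rewrite -addrA (@powRD _ x k%:R) ?powR_mulrn ?(ltW x0)// (gt_eqF x0) implybT.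
Qed.

(** Passes from the open half-line of the gamma integrals to the closed one of the Weyl chamber; the
    formula for [f] has to hold only off the null point 0. *)
Lemma integral_gamma_itv0 (f : R -> R) (c a b : R) :
  measurable_fun setT f -> 0 < a -> 0 < b ->
  (forall x, 0 < x -> f x = c * gamma_integrand a b x) ->
  mu.-integrable `[0, +oo[ (EFin \o f) /\
  \int[mu]_(x in `[0, +oo[) f x = c * (b `^ (- a) * Gamma a).
Proof.
move=> mf a0 b0 fE.
have ig : mu.-integrable `]0, +oo[ (EFin \o f).
  have mD : measurable (`]0%R, +oo[%classic : set (measurableTypeR R)).
    exact: measurable_itv.
  apply: (@eq_integrable _ _ _ mu _ mD _ _ _
    (integrableZl mD c (integrable_gamma_integrand a0 b0))).
  by move=> x; rewrite inE/= in_itv/= andbT => x0; rewrite fE.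
have mEf D : measurable_fun D (EFin \o f) by exact/measurable_EFinP/measurable_funTS.
split.
  apply/integrableP; split; first exact: mEf.
  rewrite -integral_itv_obnd_cbnd; last by apply: measurableT_comp => //.
  by have /integrableP[] := ig.
rewrite -Rintegral_itv_obnd_cbnd//.
have -> : \int[mu]_(x in `]0, +oo[) f x =
    \int[mu]_(x in `]0, +oo[) (c * gamma_integrand a b x).
  by apply: eq_Rintegral => x; rewrite inE/= in_itv/= andbT => x0; rewrite fE.
rewrite RintegralZl//; last exact: integrable_gamma_integrand.
by congr (_ * _); rewrite /Rintegral -/(gamma_integral a b) gamma_integralE.
Qed.

Let measurable_gamma_weight D : measurable_fun D gamma_weight.
Proof.
rewrite (_ : gamma_weight = fun x => (Gamma beta)^-1 * gamma_integrand beta 1 x).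
  by apply: measurable_funM => //; exact: measurable_gamma_integrand.
by apply/funext => x; rewrite /gamma_integrand mul1r /gamma_weight mulrA.
Qed.

(** One of the two Vandermonde factors absorbs the weights, which gives the product of determinants
    in the Andreief identity. *)
Lemma laguerre_densityE (x : N.-tuple R) :
  laguerre_density beta x = \det (\matrix_(i, j) tnth x i ^+ j) *
    \det (\matrix_(i, j < N) (gamma_weight (tnth x i) * tnth x i ^+ j)).
Proof.
rewrite /laguerre_density det_mul_row vandermondeE expr2 -mulrA; congr (_ * _).
by rewrite mulrC.
Qed.

(** The entries are the moments of [gamma_weight]. *)
Definition laguerre_hankel : R :=
  \det (\matrix_(i < N, j < N) ((Gamma beta)^-1 * Gamma ((i + j)%:R + beta))).

Lemma laguerre_constE : laguerre_const N beta = laguerre_hankel^-1.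
Proof.
rewrite /laguerre_const /laguerre_hankel; congr (_^-1).
pose f (i : 'I_N) (x : R) := x ^+ i.
pose g (j : 'I_N) (x : R) := gamma_weight x * x ^+ j.
have h i j := @integral_gamma_itv0 (fun x => f i x * g j x)
  (Gamma beta)^-1 ((i + j)%:R + beta) 1.
have {}h i j : mu.-integrable `[0, +oo[ (EFin \o (fun x => f i x * g j x)) /\
    \int[mu]_(x in `[0, +oo[) (f i x * g j x) =
    (Gamma beta)^-1 * Gamma ((i + j)%:R + beta).
  have [| | | |-> ->] := h i j => //.
  - apply: measurable_funM; first exact: measurable_funX.
    by apply: measurable_funM => //; exact: measurable_funX.
  - move=> x x0; rewrite -(gamma_integrand_monomial 1 beta)//.
    rewrite /f /g /gamma_weight /gamma_integrand mul1r exprD; ring.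
  - by rewrite powR1 mul1r.
have [_] := weyl_andreief (fun i j => (h i j).1).
under eq_integral do rewrite -laguerre_densityE.
move=> ->; rewrite /=; congr (\det _); apply/matrixP => i j; rewrite !mxE.
exact: (h i j).2.
Qed.

(** The falling factorial kills the terms [n < k]; shifting by [k] produces [sigma^k] and reduces
    the factorial quotient to [1 / n!]. The rising factorial raises the argument of Gamma by [j],
    and [(1 + sigma)^j] compensates in the power. What remains is the negative binomial series at
    [k + j + beta]. *)
Lemma sum_ffact_meixner (k j : nat) :
  (\sum_(0 <= n <oo) ((n ^_ k)%:R * (\prod_(0 <= l < j) (n%:R + beta + l%:R) *
     meixner_weight beta sigma n))%:E =
   (sigma ^+ k * (1 + sigma) ^+ j *
    ((Gamma beta)^-1 * Gamma ((k + j)%:R + beta)))%:E)%E.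
Proof.
have G0 (a : R) : 0 <= Gamma a by exact: Gamma_ge0.
have t0 n : (0 <= ((n ^_ k)%:R * (\prod_(0 <= l < j) (n%:R + beta + l%:R) *
     meixner_weight beta sigma n))%:E)%E.
  rewrite lee_fin mulr_ge0// mulr_ge0//.
    by apply: prodr_ge0 => l _; rewrite addr_ge0 ?(ltW (naddb _)).
  rewrite /meixner_weight /gen_binomial.
  by rewrite !mulr_ge0 ?exprn_ge0 ?powR_ge0 ?invr_ge0 ?mulr_ge0// ltW.
rewrite (nneseries_split 0 k)// add0n big1_seq ?add0e; last first.
  by move=> n /andP[_]; rewrite mem_index_iota => /andP[_ nk]; rewrite ffact_small// mul0r.
rewrite -nneseries_addn//.
have a0 : 0 < (k + j)%:R + beta by [].
transitivity (\sum_(0 <= n <oo)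
  ((sigma ^+ k * (1 + sigma) ^+ j * (Gamma beta)^-1)%:E *
   (sigma ^+ n / n`!%:R * Gamma (n%:R + ((k + j)%:R + beta)) *
    (1 + sigma) `^ (- (n%:R + ((k + j)%:R + beta))))%:E))%E.
  apply: eq_eseriesr => n _; rewrite -EFinM; congr EFin.
  rewrite /meixner_weight /gen_binomial.
  have -> : Gamma (n%:R + ((k + j)%:R + beta)) =
      \prod_(0 <= l < j) ((n + k)%:R + beta + l%:R) * Gamma ((n + k)%:R + beta).
    by rewrite -(Gamma_addn j (naddb (n + k))); congr Gamma; rewrite !natrD; ring.
  have -> : (1 + sigma) `^ (- (n%:R + ((k + j)%:R + beta))) =
      (1 + sigma) `^ (- (n + k)%:R - beta) * (1 + sigma) ^- j.
    rewrite -powR_invn ?(ltW sigma1_gt0)// -powRD; last first.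
      by rewrite (gt_eqF sigma1_gt0) implybT.
    by congr (_ `^ _); rewrite !natrD; ring.
  have -> : ((n + k)`!%:R : R) = ((n + k) ^_ k)%:R * n`!%:R.
    by rewrite -natrM -(@ffact_fact (n + k) k) ?leq_addl// addnK.
  have n0 : (n`!%:R : R) != 0 by rewrite pnatr_eq0 -lt0n fact_gt0.
  have k0 : (((n + k) ^_ k)%:R : R) != 0 by rewrite pnatr_eq0 -lt0n ffact_gt0 leq_addl.
  have s0 : (1 + sigma) ^+ j != 0 by rewrite expf_neq0// gt_eqF.
  rewrite exprD invfM.
  (* If [Gamma beta] were 0, both sides would vanish, the inverse of 0 being 0; otherwise it is a
     legitimate denominator. *)
  have [->|g0] := eqVneq (Gamma beta) 0; first by rewrite invr0 !(mulr0, mul0r).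
  by field; rewrite g0 n0 k0 s0.
rewrite nneseriesZl; last first.
  by move=> n _; rewrite lee_fin !mulr_ge0 ?exprn_ge0 ?invr_ge0 ?powR_ge0// ltW.
rewrite negative_binomial_series// ?ltW// -EFinM; congr EFin; ring.
Qed.

Let meixner_weight_ge0 n : 0 <= meixner_weight beta sigma n.
Proof.
rewrite /meixner_weight /gen_binomial.
by rewrite !mulr_ge0 ?exprn_ge0 ?powR_ge0 ?invr_ge0 ?mulr_ge0 ?Gamma_ge0// ltW.
Qed.

Lemma meixner_density_ge0 (y : N.-tuple nat) : 0 <= meixner_density beta sigma y.
Proof. by rewrite mulr_ge0 ?sqr_ge0// prodr_ge0. Qed.

Lemma det_rising_meixner (y : 'I_N -> nat) :
  \det (\matrix_(i < N, j < N) ((\prod_(0 <= l < j) ((y i)%:R + beta + l%:R)) *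
    meixner_weight beta sigma (y i))) =
  vandermonde (fun i => (y i)%:R) * \prod_i meixner_weight beta sigma (y i).
Proof.
rewrite mulrC -(det_prod_sub (fun l => - (beta + l%:R))).
rewrite -(det_mul_row (fun i => meixner_weight beta sigma (y i))); congr (\det _).
apply/matrixP => i j; rewrite !mxE mulrC; congr (_ * _).
by apply: eq_bigr => l _; rewrite opprK addrA.
Qed.

Lemma det_ffact (y : 'I_N -> nat) :
  \det (\matrix_(i < N, j < N) ((y i) ^_ j)%:R) = vandermonde (fun i => (y i)%:R) :> R.
Proof.
rewrite -(det_prod_sub (fun l => l%:R)); congr (\det _).
by apply/matrixP => i j; rewrite !mxE natr_ffact.
Qed.

(** Falling factorials in one determinant and rising ones in the other make every pairing a single
    series summed by [sum_ffact_meixner]. *)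
Lemma meixner_densityE (y : N.-tuple nat) :
  meixner_density beta sigma y =
  \det (\matrix_(i < N, j < N) ((tnth y i) ^_ j)%:R) *
  \det (\matrix_(i < N, j < N) ((\prod_(0 <= l < j) ((tnth y i)%:R + beta + l%:R)) *
    meixner_weight beta sigma (tnth y i))).
Proof.
by rewrite det_ffact det_rising_meixner mulrA.
Qed.

(** The Andreief identity is applied to functions of the integer parts, which turns the sum over
    lattice points into an integral over the continuous chamber. *)
Lemma esum_meixner_density :
  (\esum_(y in @weyl_d N) (meixner_density beta sigma y)%:E =
   (\det (\matrix_(i < N, j < N) (sigma ^+ i * (1 + sigma) ^+ j *
      ((Gamma beta)^-1 * Gamma ((i + j)%:R + beta)))))%:E)%E.
Proof.
pose f (i : 'I_N) (x : R) : R := ((Num.truncn x) ^_ i)%:R.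
pose g (j : 'I_N) (x : R) : R :=
  (\prod_(0 <= l < j) ((Num.truncn x)%:R + beta + l%:R)) *
  meixner_weight beta sigma (Num.truncn x).
pose K (i j : 'I_N) (n : nat) : R :=
  (n ^_ i)%:R * ((\prod_(0 <= l < j) (n%:R + beta + l%:R)) *
    meixner_weight beta sigma n).
have fgK i j : (fun x => f i x * g j x) = (fun x => K i j (Num.truncn x)) by [].
have K0 i j n : 0 <= K i j n.
  rewrite mulr_ge0// mulr_ge0// prodr_ge0// => l _.
  by rewrite addr_ge0 ?(ltW (naddb _)).
have intE i j : (\int[mu]_(x in `[0%R, +oo[) (f i x * g j x)%:E =
    (sigma ^+ i * (1 + sigma) ^+ j *
     ((Gamma beta)^-1 * Gamma ((i + j)%:R + beta)))%:E)%E.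
  rewrite -sum_ffact_meixner.
  rewrite -(@ge0_integral_truncn _ (fun n => (K i j n)%:E))// => m.
  by rewrite lee_fin K0.
have ifg i j : mu.-integrable `[0, +oo[ (EFin \o (fun x => f i x * g j x)).
  apply/integrableP; split.
    apply/measurable_EFinP/measurable_funTS; rewrite fgK; exact: measurable_truncn.
  under eq_integral do rewrite /= ger0_norm ?K0//.
  by rewrite intE ltry.
have [_] := weyl_andreief ifg.
rewrite (_ : \matrix_(i, j) \int[mu]_(x in _) _ =
    \matrix_(i < N, j < N) (sigma ^+ i * (1 + sigma) ^+ j *
      ((Gamma beta)^-1 * Gamma ((i + j)%:R + beta)))); last first.
  by apply/matrixP => i j; rewrite !mxE /Rintegral intE.
move=> <-.
pose H (y : N.-tuple nat) : R :=
  if y \in @weyl_d N then meixner_density beta sigma y else 0.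
have HE (x : N.-tuple R) :
    (if all (>= 0%R) x then (H (map_truncn x))%:E else 0%E) =
    ((fun x => (\det (\matrix_(i, j) f j (tnth x i)) *
                \det (\matrix_(i, j) g j (tnth x i)))%:E) \_ (weyl_c N)) x.
  have ty i : tnth (map_truncn x) i = Num.truncn (tnth x i) by rewrite tnth_map.
  have dE : \det (\matrix_(i, j) f j (tnth x i)) * \det (\matrix_(i, j) g j (tnth x i)) =
      meixner_density beta sigma (map_truncn x).
    rewrite meixner_densityE; congr (_ * _).
      by congr (\det _); apply/matrixP => i j; rewrite !mxE ty.
    by congr (\det _); apply/matrixP => i j; rewrite !mxE ty.
  rewrite patchE dE /H.
  have [W|W] := pselect (weyl_c N x).
    rewrite (_ : all _ x = true); last by apply/all_tnthP => i; exact: W.1.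
    rewrite [in RHS]mem_set//; case: ifPn => // /negP yW; congr EFin.
    (* On the chamber the integer parts increase weakly, so outside [weyl_d] two of them coincide
       and the determinant is 0. *)
    rewrite meixner_densityE (@det_tie _ _ _ (fun l m => (m ^_ l)%:R)) ?mul0r// => yi.
    apply: yW; rewrite inE => i j ij; rewrite ltn_neqAle.
    rewrite !ty le_truncn ?W.2 ?(ltnW ij)// andbT -!ty.
    by apply: contraTneq ij => /yi ->; rewrite ltnn.
  rewrite [in RHS]memNset//; case: ifPn => // /all_tnthP x0.
  (* Conversely, strictly increasing integer parts force the coordinates themselves to increase. *)
  case: ifPn => //; rewrite inE => yW; exfalso; apply: W; apply: sorted_weyl_c => //.
  apply/tuple_ltP => i j /yW; rewrite !ty => tij.
  rewrite ltNge; apply: contraTN tij => xji; rewrite -leqNgt; exact: le_truncn.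
rewrite esum_mkcond.
transitivity (\esum_(y in [set: N.-tuple nat]) (H y)%:E)%E.
  by apply: eq_esum => y _; rewrite /H; case: ifP.
rewrite -ge0_integral_map_truncn.
- by rewrite [RHS]integral_mkcond; apply: eq_integral => x _; exact: HE.
- by move=> y; rewrite /H; case: ifP => // _; exact: meixner_density_ge0.
have mt (i : 'I_N) (h : nat -> R) :
    measurable_fun setT (fun x : N.-tuple R => h (tnth (map_truncn x) i)).
  under eq_fun do rewrite tnth_map.
  exact: (measurableT_comp (measurable_truncn h) (measurable_tnth i)).
have mWd : measurable [set x : N.-tuple R | weyl_d (map_truncn x)].
  rewrite (_ : [set x : N.-tuple R | _] =
      \bigcap_(i in [set: 'I_N]) \bigcap_(j in [set j : 'I_N | (i < j)%N])
      ~` [set x : N.-tuple R | (tnth (map_truncn x) j)%:R <=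
                               (tnth (map_truncn x) i)%:R :> R]); last first.
    apply/seteqP; split => x /= h.
      by move=> i _ j ij /=; rewrite ler_nat leqNgt h.
    by move=> i j ij; have /= := h i I j ij; rewrite ler_nat ltnNge => /negP.
  apply: fin_bigcap_measurable => // i _.
  apply: fin_bigcap_measurable => // j _.
  apply: measurableC; rewrite -[X in measurable X]setTI.
  by apply: measurable_fun_le => //; exact: (mt _ (fun m => m%:R)).
rewrite (_ : (fun x => _) =
    (fun x : N.-tuple R => meixner_density beta sigma (map_truncn x)) \_
    [set x : N.-tuple R | weyl_d (map_truncn x)]); last first.
  apply/funext => x; rewrite patchE /H.
  by congr (if _ then _ else _); apply/idP/idP; rewrite !inE.
apply/(measurable_restrictT _ mWd).
apply: measurable_funTS; rewrite /meixner_density; apply: measurable_funM.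
  apply: measurable_funX; rewrite /vandermonde.
  apply: measurable_prod => i _.
  under eq_fun do rewrite big_mkcond.
  apply: measurable_prod => j _.
  case: (i < j)%N => //.
  by apply: measurable_funB; exact: (mt _ (fun m => m%:R)).
by apply: measurable_prod => i _; exact: mt.
Qed.

(** The powers of [sigma] leave the rows and those of [1 + sigma] the columns, each with exponent
    [0 + 1 + ... + (N - 1)]. *)
Lemma meixner_constE :
  meixner_const N beta sigma =
  (sigma ^+ (N * N.-1)./2 * (1 + sigma) ^+ (N * N.-1)./2 * laguerre_hankel)^-1.
Proof.
rewrite /meixner_const esum_meixner_density /=; congr (_^-1).
under eq_mx do rewrite -mulrA.
rewrite det_mul_row prodrXr sum_ord -mulrA; congr (_ * _).
under eq_mx do rewrite mulrC.
by rewrite det_mul_col prodrXr sum_ord.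
Qed.

Lemma integral_laguerre (g : N.-tuple R -> R) : measurable_fun setT g ->
  (\int[laguerre beta]_x (g x)%:E =
   \int[L N]_x (g x * ((fun x => laguerre_const N beta *
     laguerre_density beta x) \_ (weyl_c N)) x)%:E)%E.
Proof.
have c0 : 0 <= laguerre_const N beta.
  rewrite /laguerre_const invr_ge0 fine_ge0// integral_ge0// => x _.
  by rewrite lee_fin laguerre_density_ge0.
apply: integral_density.
- apply/(measurable_restrictT _ (@measurable_weyl_c R N)); apply: measurable_funTS.
  by apply: measurable_funM => //; exact: measurable_laguerre_density.
- by move=> x; rewrite patchE; case: ifPn => // _; rewrite mulr_ge0// laguerre_density_ge0.
move=> A mA; rewrite -[LHS]/(laguerre beta A) /laguerre.
transitivity (\int[L N]_(x in A `&` weyl_c N)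
  ((laguerre_const N beta)%:E * (laguerre_density beta x)%:E))%E; last first.
  rewrite integral_mkcondr; apply: eq_integral => x _.
  by rewrite !patchE; case: ifP.
rewrite ge0_integralZl//.
- by apply: measurableI => //; exact: measurable_weyl_c.
- by apply/measurable_EFinP/measurable_funTS; exact: measurable_laguerre_density.
- by move=> x _; rewrite lee_fin laguerre_density_ge0.
Qed.

Lemma vandermonde_gt0 (x : N.-tuple R) : sorted <%R x -> 0 < vandermonde (tnth x).
Proof.
move=> /tuple_ltP xS; apply: prodr_gt0 => i _; apply: prodr_gt0 => j ij.
by rewrite subr_gt0 xS.
Qed.

Lemma weyl_c_distinctP (x : N.-tuple R) :
  weyl_c_distinct N x <-> weyl_c N x /\ sorted <%R x.
Proof.
split=> [[W xi]|[W S]]; first by split => //; exact: weyl_c_sorted.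
by split => //; exact: sorted_injective.
Qed.

(** * The Laguerre ensemble transported by the kernel *)

Variable lambda : N.-tuple nat.

(** The mass at [tnth lambda j] of the Poisson law with mean [sigma * x]. *)
Definition poisson_density (x : R) (j : 'I_N) : R :=
  (sigma * x) ^+ tnth lambda j * expR (- (sigma * x)) / (tnth lambda j)`!%:R.

Let measurable_poisson_density j : measurable_fun setT (poisson_density ^~ j).
Proof.
apply: measurable_funM => //; apply: measurable_funM.
  by apply: measurable_funX; exact: measurable_funM.
by apply: measurableT_comp => //; apply: measurableT_comp.
Qed.

(** The Vandermonde denominator of the kernel cancels one of the two factors of the density, and the
    Poisson determinant absorbs the gamma weights. Ties form a null set of the Laguerre measure, as
    its density vanishes there, so the kernel can be replaced by its explicit formula. *)
Lemma integral_Lambda :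
  (\int[laguerre beta]_(x in weyl_c N) (Lambda sigma x lambda)%:E =
   \int[L N]_(x in weyl_c N) (laguerre_const N beta *
     (sigma ^- ((N * N.-1)./2) * vandermonde (fun j => (tnth lambda j)%:R)) *
     (\det (\matrix_(i, j) tnth x i ^+ j) *
      \det (\matrix_(i, j < N)
        (gamma_weight (tnth x i) * poisson_density (tnth x i) j))))%:E)%E.
Proof.
pose S := [set x : N.-tuple R | sorted <%R x].
have mS : measurable S := @measurable_sorted R N.
have mW := @measurable_weyl_c R N.
pose E := weyl_c N `\` S.
have mE : measurable E by exact: measurableD.
have dens0 x : E x -> laguerre_density beta x = 0.
  move=> [W S0]; rewrite /laguerre_density vandermondeE.
  rewrite (@det_tie _ _ _ (fun j t => t ^+ j)) ?expr0n ?mul0r// => xi.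
  by apply: S0; exact: weyl_c_sorted.
have E0 : laguerre beta E = 0%E.
  rewrite /laguerre integral0_eq ?mule0// => x [Ex _]; by rewrite dens0.
rewrite integral_mkcond (integral_null_patch _ mE E0).
(* [powR] rather than an inverse, for which there is no measurability lemma. *)
pose k (x : N.-tuple R) : R := sigma ^- ((N * N.-1)./2) *
  (vandermonde (fun j => (tnth lambda j)%:R) * vandermonde (tnth x) `^ (-1)) *
  \det (\matrix_(i < N, j < N) poisson_density (tnth x i) j).
pose g := k \_ (weyl_c N `&` S).
have gE : {in setT, ((fun x => (Lambda sigma x lambda)%:E) \_ (weyl_c N)) \_
    (~` E) =1 EFin \o g}.
  move=> x _; rewrite /g /= !patchE.
  have [W|W] := pselect (weyl_c N x); last first.
    rewrite !(memNset W) if_same memNset// => -[//].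
  rewrite (mem_set W); have [Sx|Sx] := pselect (S x); last first.
    by rewrite memNset; [rewrite memNset// => -[]|move=> h; apply: h; split].
  rewrite mem_set; last by move=> [].
  rewrite (mem_set (conj W Sx : (weyl_c N `&` S) x)).
  congr EFin; rewrite /Lambda mem_set; last exact/weyl_c_distinctP.
  rewrite /kernel_formula /k powR_inv1//; exact/ltW/vandermonde_gt0.
rewrite (eq_integral _ _ gE) integral_laguerre; last first.
  apply/(measurable_restrictT _ (measurableI _ _ mW mS)); apply: measurable_funTS.
  apply: measurable_funM; [apply: measurable_funM => //; apply: measurable_funM => //|].
    apply: (measurableT_comp (measurable_powR _)).
    rewrite /vandermonde; apply: measurable_prod => i _.
    under eq_fun do rewrite big_mkcond.
    apply: measurable_prod => j _; case: (i < j)%N => //.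
    by apply: measurable_funB; exact: measurable_tnth.
  rewrite /determinant; apply: measurable_sum => s; apply: measurable_funM => //.
  apply: measurable_prod => i _; under eq_fun do rewrite mxE.
  exact: (measurableT_comp (measurable_poisson_density (s i)) (measurable_tnth i)).
rewrite [RHS]integral_mkcond; apply: eq_integral => x _.
rewrite restrict_EFin; congr EFin; rewrite /g !patchE.
have [W|W] := pselect (weyl_c N x); last by rewrite !(memNset W) mulr0.
(* On ties the left side is 0 by the patch, the right side by its Vandermonde determinant. *)
rewrite !(mem_set W); have [Sx|Sx] := pselect (S x); last first.
  rewrite memNset ?mul0r; last by move=> [].
  rewrite (@det_tie _ _ _ (fun j t => t ^+ j)) ?mul0r ?mulr0// => xi.
  by apply: Sx; exact: weyl_c_sorted.
rewrite (mem_set (conj W Sx : (weyl_c N `&` S) x)).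
have V0 := vandermonde_gt0 Sx.
rewrite /k powR_inv1 ?ltW// laguerre_densityE !det_mul_row -!vandermondeE.
set s := sigma ^- _; by field; rewrite gt_eqF.
Qed.

(** With [n = tnth lambda j] the integrand is a multiple of the gamma integrand of shape
    [i + n + beta] and rate [1 + sigma]; the recurrence of Gamma extracts a rising factorial of
    degree [i] in [n]. *)
Lemma poisson_moment (i j : 'I_N) :
  mu.-integrable `[0, +oo[
    (EFin \o (fun x => x ^+ i * (gamma_weight x * poisson_density x j))) /\
  \int[mu]_(x in `[0, +oo[) (x ^+ i * (gamma_weight x * poisson_density x j)) =
  \prod_(0 <= l < i) ((tnth lambda j)%:R + beta + l%:R) *
    meixner_weight beta sigma (tnth lambda j) * (1 + sigma) ^- i.
Proof.
set n := tnth lambda j.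
have [| | | |-> ->] := @integral_gamma_itv0
  (fun x => x ^+ i * (gamma_weight x * poisson_density x j))
  ((Gamma beta)^-1 * sigma ^+ n / n`!%:R) ((i + n)%:R + beta) (1 + sigma).
- apply: measurable_funM; first exact: measurable_funX.
  apply: measurable_funM; first exact: measurable_gamma_weight.
  exact: measurable_poisson_density.
- exact: naddb.
- exact: sigma1_gt0.
- move=> x x0; rewrite -(gamma_integrand_monomial (1 + sigma) beta)//.
  rewrite /gamma_weight /poisson_density -/n /gamma_integrand.
  rewrite (_ : - ((1 + sigma) * x) = - x + - (sigma * x)); last by ring.
  by rewrite expRD exprD exprMn; ring.
split => //; rewrite /meixner_weight /gen_binomial.
have -> : Gamma ((i + n)%:R + beta) =
    \prod_(0 <= l < i) (n%:R + beta + l%:R) * Gamma (n%:R + beta).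
  by rewrite -(Gamma_addn i (naddb n)); congr Gamma; rewrite natrD addrA.
have -> : (1 + sigma) `^ (- ((i + n)%:R + beta)) =
    (1 + sigma) `^ (- n%:R - beta) * (1 + sigma) ^- i.
  rewrite -powR_invn ?(ltW sigma1_gt0)// -powRD; last first.
    by rewrite (gt_eqF sigma1_gt0) implybT.
  by congr (_ `^ _); rewrite natrD; ring.
by rewrite invfM; ring.
Qed.

(** The rising factorials are monic polynomials in [tnth lambda j] and yield the second Vandermonde
    factor, the first coming from the kernel. *)
Lemma det_poisson_moments :
  \det (\matrix_(i < N, j < N) \int[mu]_(x in `[0, +oo[)
    (x ^+ i * (gamma_weight x * poisson_density x j))) =
  (1 + sigma) ^- ((N * N.-1)./2) * vandermonde (fun j => (tnth lambda j)%:R) *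
  \prod_j meixner_weight beta sigma (tnth lambda j).
Proof.
rewrite -det_tr.
transitivity (\det (\matrix_(j < N, i < N)
  (((\prod_(0 <= l < i) ((tnth lambda j)%:R + beta + l%:R)) *
    meixner_weight beta sigma (tnth lambda j)) * (1 + sigma) ^- i))).
  congr (\det _); apply/matrixP => j i; rewrite !mxE.
  exact: (poisson_moment i j).2.
rewrite det_mul_col det_rising_meixner -mulrA; congr (_ * _).
rewrite -sum_ord -prodrXr -prodfV.
by apply: eq_bigr => i _.
Qed.

(** With [M = N (N - 1) / 2], the factor [sigma^(-M)] of the kernel, the factor [(1 + sigma)^(-M)]
    of the moments and the Laguerre constant multiply to the Meixner constant. *)
Lemma laguerre_Lambda :
  (\int[laguerre beta]_(x in weyl_c N) (Lambda sigma x lambda)%:E =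
   (meixner beta sigma lambda)%:E)%E.
Proof.
rewrite integral_Lambda.
have [iF intF] := weyl_andreief (fun i j => (poisson_moment i j).1).
under eq_integral do rewrite EFinM.
rewrite integralZl//; last exact: measurable_weyl_c.
rewrite intF det_poisson_moments -EFinM /meixner meixner_constE laguerre_constE; congr EFin.
by rewrite !invfM /meixner_density; ring.
Qed.

End ensembles.

Unset Implicit Arguments.
Set Strict Implicit.

Theorem proposition1p12 (R : realType) (sigma beta : R) (N : nat)
    (sigma_gt0 : 0 < sigma) (beta_gt0 : 0 < beta) (N_gt0 : (1 <= N)%N)
    (lambda : N.-tuple nat) (lambdaW : weyl_d lambda) :
  (\int[laguerre beta]_(x in weyl_c N) (Lambda sigma x lambda)%:E
   = (meixner beta sigma lambda)%:E)%E.
Proof. exact: laguerre_Lambda. Qed.
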